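(* Let $(\mathbf{x}_e,\mathbf{x}_p)$ be a type-(ii) periodic orbit. If properties (P2) and (P3) hold, with image trajectory $\mathbf{X}_\mu$ and time shift $\tau$, then the natural functions $$\Delta_s^{\pm}(t,\mathbf{x})=\phi_p^{\pm}(t,\mathbf{x})-\phi_\mu^{\pm}(t+\tau,\mathbf{x}),\qquad (t,\mathbf{x})\in\mathbb{R}\times\mathbb{R}^3,$$ and their first derivatives $\vec\nabla\Delta_s^{\pm}(t,\mathbf{x})$ and $\partial_t\Delta_s^{\pm}(t,\mathbf{x})$ are continuous, bounded, and vanish at breaking points (i.e. at those $(t,\mathbf{x})$ for which $t_p^{\pm}(t,\mathbf{x})$ is a protonic breaking time).
   Context: Units: speed of light $c=1$; electron (index $e$ or $1$) has charge $e_1=-1$ and mass $m_1=1$; proton (index $p$ or $2$) has charge $e_2=1$ and mass $m_2=M_p$ (arbitrary). Trajectories and delays. A bounded trajectory is a continuous $\mathbf{x}_j:\mathbb{R}\to\mathbb{R}^3$ with bounded image; it is sub-luminal if $|\dot{\mathbf{x}}_j(t)|<1$ with the possible exception of a countable set of $t$. For such a trajectory the delay functions $\phi_j^{\pm}(t,\mathbf{x})\ge0$ are the unique solutions of $\phi_j^{\pm}=|\mathbf{x}-\mathbf{x}_j(t\pm\phi_j^{\pm})|$ on $\mathbb{R}\times\mathbb{R}^3$; put $t_j^{\pm}(t,\mathbf{x})=t\pm\phi_j^{\pm}(t,\mathbf{x})$. Quantities $\mathbf{x}_j^\pm,\mathbf{v}_j^\pm,\mathbf{a}_j^\pm$ are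 position, velocity, acceleration of $j$ at time $t_j^\pm(t,\mathbf{x})$, and $\hat{\mathbf{n}}_j^{\pm}(t,\mathbf{x})=(\mathbf{x}-\mathbf{x}_j^\pm)/|\mathbf{x}-\mathbf{x}_j^\pm|$. When the trajectory possesses a velocity at time $t_j^\pm(t,\mathbf{x})$, $\vec\nabla\phi_j^\pm=\hat{\mathbf{n}}_j^\pm/(1\pm\hat{\mathbf{n}}_j^\pm\cdot\mathbf{v}_j^\pm)$ and $\partial_t\phi_j^\pm=-\hat{\mathbf{n}}_j^\pm\cdot\mathbf{v}_j^\pm/(1\pm\hat{\mathbf{n}}_j^\pm\cdot\mathbf{v}_j^\pm)$. Orbits. An orbit is a pair of bounded trajectories $(\mathbf{x}_e,\mathbf{x}_p)$, each possessing two derivatives defined piecewise, such that: (a) on each $C^2$ segment the Wheeler–Feynman equations hold: for $i\in\{1,2\}$, $j=3-i$, $\frac{m_i\mathbf{a}_i(t)}{\sqrt{1-\mathbf{v}_i^2}}=e_i[\mathbf{E}_j-(\mathbf{v}_i\cdot\mathbf{E}_j)\mathbf{v}_i+\mathbf{v}_i\times\mathbf{B}_j]$, where $\mathbf{E}_j=\frac12(\mathbf{E}_j^++\mathbf{E}_j^-)$, $\mathbf{B}_j=\frac12(\mathbf{B}_j^++\mathbf{B}_j^-)$ are evaluated at $(t,\mathbf{x}_i(t))$, with $\mathbf{E}_j^\pm(t,\mathbf{x})=e_j(1-|\mathbf{v}_j^\pm|^2)\frac{|\vec\nabla\phi_j^\pm|^3}{(\phi_j^\pm)^2}(\hat{\mathbf{n}}_j^\pm\pm\mathbf{v}_j^\pm)+e_j\frac{\hat{\mathbf{n}}_j^\pm\times(\hat{\mathbf{n}}_j^\pm\times\mathbf{J}_j^\pm)}{\phi_j^\pm}$,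 $\mathbf{B}_j^\pm=\mp\hat{\mathbf{n}}_j^\pm\times\mathbf{E}_j^\pm$, $\mathbf{J}_j^\pm=|\vec\nabla\phi_j^\pm|^3(\mathbf{a}_j^\pm\mp\hat{\mathbf{n}}_j^\pm\times(\mathbf{v}_j^\pm\times\mathbf{a}_j^\pm))$; (b) at velocity discontinuities the left and right values agree (Weierstrass–Erdmann conditions) for $\mathbf{P}_i=\frac{m_i\mathbf{v}_i}{\sqrt{1-\mathbf{v}_i^2}}-\Big(\frac{\mathbf{v}_j^-}{2r_{ji}^-D_{ji}^-}+\frac{\mathbf{v}_j^+}{2r_{ji}^+D_{ji}^+}\Big)$ and $E_i=\frac{m_i}{\sqrt{1-\mathbf{v}_i^2}}-\Big(\frac{1}{2r_{ji}^-D_{ji}^-}+\frac{1}{2r_{ji}^+D_{ji}^+}\Big)$, where $r_{ji}^\pm=\phi_j^\pm(t,\mathbf{x}_i(t))$, $D_{ji}^\pm=1/|\vec\nabla\phi_j^\pm(t,\mathbf{x}_i(t))|$. A type-(ii) orbit is a periodic orbit (period $T$) whose velocities have modulus less than $1$ wherever defined and are discontinuous on a countable set of points (breaking points; the corresponding times are breaking times). Property (P2): there are $\mu\in\mathbb{R}$ and a bounded $C^2$ vector function $\mathtt{G}:\mathbb{R}\to\mathbb{R}^3$ (the guiding trajectory) such that the globally defined image trajectory $\mathbf{X}_\mu(t)=-\mathtt{G}(t)+\mu\,\mathbf{x}_e(t)$, $t\in\mathbb{R}$, is sub-luminal, i.e. $|\dot{\mathbf{X}}_\mu|=|\dot{\mathtt{G}}-\mu\mathbf{v}_e|<1$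 with the possible exception of a countable set of points. Additionally, the protonic breaking points are mapped by a one-to-one correspondence onto the breaking points of the image trajectory according to $\mathbf{x}_p(t^* )=\mathbf{X}_\mu(t^*+\tau)$ for every protonic breaking time $t^*$, where either $\tau=0$ for all breaking points or $\tau=T/2$ for all breaking points; this also pairs each protonic breaking point, at time $t^*$, with a mirror electronic breaking point, at time $t^*+\tau$. Property (P3): at breaking points the velocities jump discontinuously while satisfying, for the one-sided velocities (left $\ell$, right $r$) at each protonic breaking time $t^*$, $\mathbf{v}_p^{\ell}(t^* )=\mathbf{V}_\mu^{\ell}(t^*+\tau)$ and $\mathbf{v}_p^{r}(t^* )=\mathbf{V}_\mu^{r}(t^*+\tau)$, where $\mathbf{V}_\mu=\dot{\mathbf{X}}_\mu=-\dot{\mathtt{G}}+\mu\mathbf{v}_e$. The synchronization functions $\phi_\mu^\pm$ are the delay functions of $\mathbf{X}_\mu$: $\phi_\mu^\pm(t,\mathbf{x})=|\mathbf{x}-\mathbf{X}_\mu(t\pm\phi_\mu^\pm)|$; their derivatives are given by the formulas above with $\mathbf{x}_j,\mathbf{v}_j$ replaced by $\mathbf{X}_\mu,\mathbf{V}_\mu$. At points $(t,\mathbf{x})$ where $t_p^\pm(t,\mathbf{x})$ is a breaking time, the first derivatives of $\Delta_s^\pm$ are evaluated from the left and from the right using the one-sided velocities.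
   Formalization: Derivatives are continuous off the world lines x=x_p(t), x=X_μ(t+τ), where they are undefined; |V_μ|<1 is required wherever the velocity exists; derivatives are bounded on bounded sets, and globally only if sup|V_μ|<1; without these the claim fails. *)

(* Defs.v *)
From HB Require Import structures.
From mathcomp Require Import all_boot all_order all_algebra.
From mathcomp Require Import all_classical all_reals all_analysis.
Import Order.TTheory GRing.Theory Num.Theory.
Import numFieldNormedType.Exports.

Set Implicit Arguments.
Unset Strict Implicit.
Unset Printing Implicit Defensive.

Local Open Scope ring_scope.
Local Open Scope classical_set_scope.

Section Vectors.
Variable R : realType.
Implicit Types u v : 'rV[R]_3.

Definition dot u v : R := \sum_i u 0 i * v 0 i.

(* The library norm `|u| on 'rV[R]_3 is the sup norm, hence this one. *)
Definition enorm u : R := Num.sqrt (dot u u).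

(* The indices i + 1 and i + 2 are taken modulo 3. *)
Definition cross u v : 'rV[R]_3 :=
  \row_(i < 3) (u 0 (i + 1) * v 0 (i + 2%:R) - u 0 (i + 2%:R) * v 0 (i + 1)).

Definition grad (f : R -> 'rV[R]_3 -> R) (t : R) (y : 'rV[R]_3) : 'rV[R]_3 :=
  \row_(i < 3) 'D_(delta_mx 0 i : 'rV[R]_3) (f t) y.

Definition dt (f : R -> 'rV[R]_3 -> R) (t : R) (y : 'rV[R]_3) : R :=
  derive1 (fun s => f s y) t.

End Vectors.

(* The superscripts + (advanced) and - (retarded) of the delay functions. *)
Inductive cone := advanced | retarded.

(* The superscripts l (left) and r (right) of the one-sided velocities. *)
Inductive side := lside | rside.

Section Trajectories.
Variable R : realType.
Implicit Types (x v a : R -> 'rV[R]_3) (t : R) (y : 'rV[R]_3).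

Definition sg (c : cone) : R := if c is advanced then 1 else -1.

Definition at_side (sd : side) t : set_system R :=
  if sd is lside then t^'- else t^'+.

Definition bounded_trajectory x := continuous x /\ bounded_set (range x).

Definition vel_quotient x t : R -> 'rV[R]_3 :=
  fun s => (s - t)^-1 *: (x s - x t).

Definition vel (sd : side) x t : 'rV[R]_3 :=
  lim (vel_quotient x t @ at_side sd t).

(* The velocity has only jump discontinuities: both one-sided derivatives exist
   at every time, and they are the one-sided limits of the velocity. Breaking
   times are allowed to accumulate. *)
Definition has_one_sided_velocities x := forall t sd,
  cvg (vel_quotient x t @ at_side sd t) /\
  forall sd', vel sd' x s @[s --> at_side sd t] --> vel sd x t.

Definition breaking x : set R := [set t | vel lside x t <> vel rside x t].

(* x is C^2 on an open interval around t. *)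
Definition C2_at x t := \forall s \near t,
  [/\ derivable x s 1, derivable (derive1 x) s 1 &
      {for s, continuous (derive1n 2 x)}].

Definition piecewise_C2 x :=
  countable (~` [set t | C2_at x t]) /\ has_one_sided_velocities x.

(* The countable exceptional set is the set of times without a velocity. *)
Definition sub_luminal x :=
  countable [set t | ~ derivable x t 1] /\
  forall t, derivable x t 1 -> enorm (derive1 x t) < 1.

Definition uniformly_sub_luminal x :=
  exists2 k : R, k < 1 & forall t, derivable x t 1 -> enorm (derive1 x t) <= k.

(* phi_j^c; the delay equation has exactly one nonnegative solution when x is a
   bounded sub-luminal trajectory with one-sided velocities of modulus < 1. *)
Definition delay (c : cone) x t y : R :=
  xget 0 [set phi | 0 <= phi /\ phi = enorm (y - x (t + sg c * phi))].

(* t_j^c *)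
Definition cone_time c x t y : R := t + sg c * delay c x t y.

(* n_j^c; the value is 0 when y = x t, where the unit vector is undefined. *)
Definition normal c x t y : 'rV[R]_3 :=
  let d := y - x (cone_time c x t y) in (enorm d)^-1 *: d.

(* Closed forms of the first derivatives of the delay function, for a choice v
   of the velocity of x (ordinary, left or right). *)
Definition grad_delay c x v t y : 'rV[R]_3 :=
  let n := normal c x t y in
  (1 + sg c * dot n (v (cone_time c x t y)))^-1 *: n.

Definition dt_delay c x v t y : R :=
  let n := normal c x t y in
  let w := v (cone_time c x t y) in
  - dot n w / (1 + sg c * dot n w).

End Trajectories.

Arguments sg {R} c.

Section WheelerFeynman.
Variable R : realType.
Implicit Types (x : R -> 'rV[R]_3) (t e m : R) (y : 'rV[R]_3).

Definition J_field c x t y : 'rV[R]_3 :=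
  let n := normal c x t y in
  let s := cone_time c x t y in
  (enorm (grad_delay c x (derive1 x) t y)) ^+ 3 *:
    (derive1n 2 x s - sg c *: cross n (cross (derive1 x s) (derive1n 2 x s))).

Definition E_field c e x t y : 'rV[R]_3 :=
  let n := normal c x t y in
  let s := cone_time c x t y in
  let phi := delay c x t y in
  (e * (1 - enorm (derive1 x s) ^+ 2)
     * (enorm (grad_delay c x (derive1 x) t y) ^+ 3 / phi ^+ 2)) *:
    (n + sg c *: derive1 x s)
  + (e / phi) *: cross n (cross n (J_field c x t y)).

Definition B_field c e x t y : 'rV[R]_3 :=
  - sg c *: cross (normal c x t y) (E_field c e x t y).

Definition E_half e x t y : 'rV[R]_3 :=
  2^-1 *: (E_field advanced e x t y + E_field retarded e x t y).

Definition B_half e x t y : 'rV[R]_3 :=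
  2^-1 *: (B_field advanced e x t y + B_field retarded e x t y).

(* Equation of motion of particle i (mass mi, charge ei, trajectory xi) in the
   field of particle j. It presupposes that the field of j is defined at
   (t, xi t), that is, xi t <> xj t (equivalently, nonzero delays). *)
Definition motion_at mi ei xi ej xj t :=
  let v := derive1 xi t in
  let E := E_half ej xj t (xi t) in
  let B := B_half ej xj t (xi t) in
  xi t <> xj t /\
  (mi / Num.sqrt (1 - enorm v ^+ 2)) *: derive1n 2 xi t =
    ei *: (E - dot v E *: v + cross v B).

Definition wheeler_feynman mi ei xi ej xj := forall t,
  C2_at xi t -> (forall c, C2_at xj (cone_time c xj t (xi t))) ->
  motion_at mi ei xi ej xj t.

(* 1 / (2 r_ji^c D_ji^c), with one-sided velocities of j. Since t |-> t_j^c(t,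
   xi t) is increasing, the left (right) value at t uses the left (right)
   velocity of j at t_j^c. *)
Definition we_weight sd c xi xj t : R :=
  enorm (grad_delay c xj (vel sd xj) t (xi t)) / (2 * delay c xj t (xi t)).

Definition momentum sd mi xi xj t : 'rV[R]_3 :=
  let v := vel sd xi t in
  let vj c := vel sd xj (cone_time c xj t (xi t)) in
  (mi / Num.sqrt (1 - enorm v ^+ 2)) *: v
  - (we_weight sd retarded xi xj t *: vj retarded
     + we_weight sd advanced xi xj t *: vj advanced).

Definition energy sd mi xi xj t : R :=
  mi / Num.sqrt (1 - enorm (vel sd xi t) ^+ 2)
  - (we_weight sd retarded xi xj t + we_weight sd advanced xi xj t).

(* The velocities entering momentum and energy at time t are those of i at t
   and those of j at the two times t_j^c. *)
Definition weierstrass_erdmann mi xi xj := forall t,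
  breaking xi t \/ (exists c, breaking xj (cone_time c xj t (xi t))) ->
  [/\ xi t <> xj t,
      momentum lside mi xi xj t = momentum rside mi xi xj t &
      energy lside mi xi xj t = energy rside mi xi xj t].

(* Electron: mass 1, charge -1. Proton: mass Mp, charge 1. *)
Record orbit (Mp : R) (xe xp : R -> 'rV[R]_3) : Prop := Orbit {
  orbit_bounded_e : bounded_trajectory xe;
  orbit_bounded_p : bounded_trajectory xp;
  orbit_piecewise_e : piecewise_C2 xe;
  orbit_piecewise_p : piecewise_C2 xp;
  orbit_motion_e : wheeler_feynman 1 (-1) xe 1 xp;
  orbit_motion_p : wheeler_feynman Mp 1 xp (-1) xe;
  orbit_corner_e : weierstrass_erdmann 1 xe xp;
  orbit_corner_p : weierstrass_erdmann Mp xp xe }.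

Record type_ii_orbit (Mp T : R) (xe xp : R -> 'rV[R]_3) : Prop := TypeIIOrbit {
  type_ii_orbit_orbit : orbit Mp xe xp;
  type_ii_period_gt0 : 0 < T;
  type_ii_periodic_e : forall t, xe (t + T) = xe t;
  type_ii_periodic_p : forall t, xp (t + T) = xp t;
  type_ii_speed_e : forall sd t, enorm (vel sd xe t) < 1;
  type_ii_speed_p : forall sd t, enorm (vel sd xp t) < 1;
  type_ii_breaking_e : countable (breaking xe);
  type_ii_breaking_p : countable (breaking xp) }.

End WheelerFeynman.

Section Image.
Variable R : realType.
Implicit Types (xe xp X G : R -> 'rV[R]_3) (mu tau T : R).

Definition image_trajectory mu G xe : R -> 'rV[R]_3 :=
  fun t => - G t + mu *: xe t.

Record property_P2 T xe xp mu G tau : Prop := PropertyP2 {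
  P2_bounded : bounded_set (range G);
  P2_C2 : forall t, C2_at G t;
  P2_sub_luminal : sub_luminal (image_trajectory mu G xe);
  P2_shift : tau = 0 \/ tau = T / 2;
  (* t |-> t + tau is a bijection from the protonic breaking times onto the
     breaking times of the image trajectory. *)
  P2_breaking : forall t,
    breaking xp t <-> breaking (image_trajectory mu G xe) (t + tau);
  P2_position : forall t, breaking xp t ->
    xp t = image_trajectory mu G xe (t + tau);
  P2_mirror : forall t, breaking xp t -> breaking xe (t + tau) }.

Definition property_P3 xe xp mu G tau := forall t, breaking xp t ->
  forall sd, vel sd xp t = vel sd (image_trajectory mu G xe) (t + tau).

Definition Delta c xp X tau (t : R) (y : 'rV[R]_3) : R :=
  delay c xp t y - delay c X (t + tau) y.

(* First derivatives of Delta evaluated with one-sided velocities. *)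
Definition grad_Delta_side sd c xp X tau (t : R) (y : 'rV[R]_3) : 'rV[R]_3 :=
  grad_delay c xp (vel sd xp) t y - grad_delay c X (vel sd X) (t + tau) y.

Definition dt_Delta_side sd c xp X tau (t : R) (y : 'rV[R]_3) : R :=
  dt_delay c xp (vel sd xp) t y - dt_delay c X (vel sd X) (t + tau) y.

(* A delay function has a conical singularity on the world line of its
   trajectory (zero delay), where its first derivatives do not exist; this is
   the complement of the two world lines involved in Delta. *)
Definition off_world_lines xp X tau : set (R * 'rV[R]_3) :=
  [set z | z.2 <> xp z.1 /\ z.2 <> X (z.1 + tau)].

End Image.

(* Main.v *)
Require Import Defs.
From HB Require Import structures.
From mathcomp Require Import all_boot all_order all_algebra.
From mathcomp Require Import all_classical all_reals all_analysis.
From mathcomp Require Import ring lra.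
Import Order.TTheory GRing.Theory Num.Theory.
Import numFieldNormedType.Exports.
Local Open Scope ring_scope.
Local Open Scope classical_set_scope.

(* On a compact time interval the one-sided speeds are bounded by some k < 1,
   so a trajectory is a k-Lipschitz map there; hence the delay equation is a
   contraction, the delays are locally Lipschitz, and away from breaking times
   they are differentiated implicitly.

   At an event (t, y) whose proton cone time is a breaking time s0, the two
   trajectories meet, so both delays coincide. Whether the cone time of a nearby
   event is before or after s0 depends only on the common position at s0, hence
   both trajectories are seen on the same side of their breaking time, with the same
   one-sided velocity v. Then |Delta| <= |v| |Delta| + o(.), and |v| < 1 gives
   Delta = o(.): the derivatives of Delta vanish there. The same matching of
   sides makes the closed forms of the derivatives cancel in the limit, hence
   their continuity. *)

Set Implicit Arguments.
Unset Strict Implicit.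
Unset Printing Implicit Defensive.

(** * The Euclidean inner product and norm in three dimensions *)

Section EuclideanNorm.
Variable R : realType.
Implicit Types (u v w : 'rV[R]_3) (a : R).

Lemma dotE u v : dot u v =
  u 0 ord0 * v 0 ord0 + u 0 (lift ord0 ord0) * v 0 (lift ord0 ord0)
  + u 0 (lift ord0 (lift ord0 ord0)) * v 0 (lift ord0 (lift ord0 ord0)).
Proof. by rewrite /dot !big_ord_recl big_ord0 addr0 addrA. Qed.

Lemma dotC u v : dot u v = dot v u.
Proof. by rewrite !dotE; ring. Qed.

Lemma dotDl u v w : dot (u + v) w = dot u w + dot v w.
Proof. by rewrite !dotE !mxE; ring. Qed.

Lemma dotZl a u v : dot (a *: u) v = a * dot u v.
Proof. by rewrite !dotE !mxE; ring. Qed.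

Lemma dotNl u v : dot (- u) v = - dot u v.
Proof. by rewrite !dotE !mxE; ring. Qed.

Lemma dotDr u v w : dot u (v + w) = dot u v + dot u w.
Proof. by rewrite dotC dotDl !(dotC u). Qed.

Lemma dotZr a u v : dot u (a *: v) = a * dot u v.
Proof. by rewrite dotC dotZl (dotC u). Qed.

Lemma dotNr u v : dot u (- v) = - dot u v.
Proof. by rewrite dotC dotNl (dotC u). Qed.

Lemma dot_ge0 u : 0 <= dot u u.
Proof. by rewrite dotE -!expr2 !addr_ge0 ?sqr_ge0. Qed.

Lemma enorm_ge0 u : 0 <= enorm u.
Proof. exact: sqrtr_ge0. Qed.

Lemma sqr_enorm u : enorm u ^+ 2 = dot u u.
Proof. by rewrite sqr_sqrtr ?dot_ge0. Qed.

Lemma enorm0 : enorm (0 : 'rV[R]_3) = 0.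
Proof. by rewrite /enorm dotE !mxE !mul0r !addr0 sqrtr0. Qed.

Lemma enormZ a u : enorm (a *: u) = `|a| * enorm u.
Proof.
by rewrite /enorm dotZl dotZr mulrA -expr2 sqrtrM ?sqr_ge0// sqrtr_sqr.
Qed.

Lemma enormN u : enorm (- u) = enorm u.
Proof. by rewrite -scaleN1r enormZ normrN1 mul1r. Qed.

Lemma enorm_distC u v : enorm (u - v) = enorm (v - u).
Proof. by rewrite -enormN opprB. Qed.

(** Cauchy-Schwarz: by Lagrange's identity the difference of the squares is the squared length of
    the cross product. *)
Lemma dot_le u v : `|dot u v| <= enorm u * enorm v.
Proof.
rewrite -ler_sqr ?nnegrE ?normr_ge0 ?mulr_ge0 ?enorm_ge0//.
rewrite real_normK ?num_real// exprMn !sqr_enorm -subr_ge0.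
have lagrange (a b c d e f : R) :
    (a * a + b * b + c * c) * (d * d + e * e + f * f) -
    (a * d + b * e + c * f) ^+ 2 =
    (a * e - b * d) ^+ 2 + (a * f - c * d) ^+ 2 + (b * f - c * e) ^+ 2 by ring.
rewrite !dotE lagrange.
by rewrite !addr_ge0 ?sqr_ge0.
Qed.

Lemma ler_enormD u v : enorm (u + v) <= enorm u + enorm v.
Proof.
rewrite -ler_sqr ?nnegrE ?addr_ge0 ?enorm_ge0//.
rewrite sqrrD !sqr_enorm dotDl !dotDr.
have := dot_le u v; rewrite ler_norml => /andP[_].
by rewrite (dotC v u) => h; lra.
Qed.

Lemma ler_enormB u v : enorm (u - v) <= enorm u + enorm v.
Proof. by rewrite -(enormN v) ler_enormD. Qed.

Lemma ler_dist_enorm u v : `|enorm u - enorm v| <= enorm (u - v).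
Proof.
rewrite ler_norml; apply/andP; split.
  by have := ler_enormD (v - u) u; rewrite subrK enorm_distC => h; lra.
by have := ler_enormD (u - v) v; rewrite subrK => h; lra.
Qed.

Lemma norm_le_enorm u : `|u| <= enorm u.
Proof.
rewrite /Num.norm/= mx_normrE; apply/bigmax_leP; split; first exact: enorm_ge0.
move=> [i j] _ /=; rewrite (ord1 i) /=.
rewrite -ler_sqr ?nnegrE ?normr_ge0 ?enorm_ge0// sqr_enorm.
rewrite real_normK ?num_real// /dot (bigD1 j)//= expr2 lerDl.
by apply: sumr_ge0 => k _; rewrite -expr2 sqr_ge0.
Qed.

(** Together with [norm_le_enorm] this carries limits, taken in the sup norm, over to Euclidean
    estimates and back. The sharp constant is the square root of 3; the cruder [3] avoids the
    root. *)
Lemma enorm_le_norm u : enorm u <= 3 * `|u|.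
Proof.
have h i : `|u 0 i| <= `|u| 
  by rewrite [leRHS]/Num.norm/= mx_normrE; apply/bigmax_geP; right; exists (0, i).
rewrite -ler_sqr ?nnegrE ?mulr_ge0 ?enorm_ge0// sqr_enorm dotE -!expr2.
have g i : u 0 i ^+ 2 <= `|u| ^+ 2.
  by rewrite -(real_normK (num_real _)) lerXn2r ?nnegrE.
rewrite exprMn.
have := g ord0; have := g (lift ord0 ord0); have := g (lift ord0 (lift ord0 ord0)).
have := sqr_ge0 `|u|.
lra.
Qed.

Lemma enorm_eq0 u : (enorm u == 0) = (u == 0).
Proof.
apply/eqP/eqP => [u0|->]; last exact: enorm0.
by apply/eqP; rewrite -normr_le0 -u0 norm_le_enorm.
Qed.

Lemma cvg_dot (T : Type) (F : set_system T) (FF : Filter F)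
    (f g : T -> 'rV[R]_3) u v :
  f @ F --> u -> g @ F --> v -> dot (f x) (g x) @[x --> F] --> dot u v.
Proof.
move=> fu gv; rewrite dotE; under eq_cvg do rewrite dotE.
by do 2?apply: cvgD; (apply: cvgM;
  [exact: cvg_comp fu (@coord_continuous R 1 3 0 _ u)
  |exact: cvg_comp gv (@coord_continuous R 1 3 0 _ v)]).
Qed.

Lemma enorm_continuous : continuous (@enorm R).
Proof.
move=> u.
apply: (cvg_comp (G := nbhs (dot u u)) (fun v => dot v v) Num.sqrt).
  exact: (@cvg_dot _ _ (nbhs_filter u) id id).
exact: sqrt_continuous.
Qed.

(** With d the change of length, squaring gives d |w| - w.h = (|h|^2 - d^2) / 2, and the triangle
    inequality |d| <= |h| bounds the right-hand side. *)
Lemma enormD_approx w h : w != 0 ->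
  `|enorm (w + h) - enorm w - dot ((enorm w)^-1 *: w) h|
    <= enorm h ^+ 2 / enorm w.
Proof.
move=> w0.
have wp : 0 < enorm w by rewrite lt_neqAle eq_sym enorm_eq0 w0 enorm_ge0.
have := ler_dist_enorm (w + h) w; rewrite (addrC (w + h) (- w)) addKr => dh.
have e : enorm (w + h) ^+ 2 = enorm w ^+ 2 + 2 * dot w h + enorm h ^+ 2.
  by rewrite !sqr_enorm dotDl !dotDr (dotC h w); ring.
rewrite dotZl ler_pdivlMr// -[X in _ * X](gtr0_norm wp) -normrM.
set d := enorm (w + h) - enorm w in dh *.
have -> : (d - (enorm w)^-1 * dot w h) * enorm w = (enorm h ^+ 2 - d ^+ 2) / 2.
  have -> : (d - (enorm w)^-1 * dot w h) * enorm w = d * enorm w - dot w h.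
    by rewrite mulrBl mulrAC mulVf ?mul1r// gt_eqF.
  have -> : dot w h = (enorm (w + h) ^+ 2 - enorm w ^+ 2 - enorm h ^+ 2) / 2 by lra.
  by rewrite /d; field.
have : d ^+ 2 <= enorm h ^+ 2.
  by rewrite -(real_normK (num_real d)) lerXn2r ?nnegrE ?enorm_ge0.
have := sqr_ge0 d; have := sqr_ge0 (enorm h).
by rewrite ler_norml => *; apply/andP; split; lra.
Qed.

End EuclideanNorm.

(** Continuous induction, used in place of compactness: the supremum of the [s] in [[a, b]] with
    [P a s] cannot be below [b], since the local property at the supremum extends [P a s] past
    it. *)
Lemma segment_induction (R : realType) (P : R -> R -> Prop) :
  (forall a b c, a <= b -> b <= c -> P a b -> P b c -> P a c) ->
  (forall t, exists2 d : R, 0 < d &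
     forall u v, t - d < u -> u <= t -> t <= v -> v < t + d -> P u v) ->
  forall a b, a <= b -> P a b.
Proof.
move=> Padd Ploc a b ab.
pose E := [set s | a <= s <= b /\ P a s].
have Ea : E a.
  have [d d0 h] := Ploc a; split; first by rewrite lexx.
  by apply: h; lra.
have supE : has_sup E.
  by split; [exists a|exists b => s [/andP[]]].
have [d d0 h] := Ploc (sup E).
have [s [/andP[as_ sb] Pas] sc] := sup_adherent d0 supE.
have sE : s <= sup E by apply: (ub_le_sup (proj2 supE)); split=> //; apply/andP.
(* Half of [d] keeps [v] inside the local radius, yet strictly beyond the supremum unless [v] is
   [b]. *)
pose v := Num.min b (sup E + d / 2).
have Eb : sup E <= b by apply: ge_sup; [exists a|move=> r [/andP[]]].
have vE : sup E <= v by rewrite le_min Eb/=; lra.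
have vb : v <= b by rewrite ge_min lexx.
have Ev : P a v.
  apply: (Padd _ s) => //; first exact: le_trans vE.
  apply: h => //.
  by rewrite gt_min; apply/orP; right; lra.
have : v <= sup E.
  apply: (ub_le_sup (proj2 supE)); split=> //.
  by rewrite vb andbT (le_trans as_)// (le_trans sE).
rewrite ge_min => /orP[bE|]; last by lra.
have vbE : v = b by apply/eqP; rewrite eq_le vb/= (le_trans bE vE).
by rewrite -vbE.
Qed.

(** * Speed bounds and Lipschitz estimates from one-sided velocities *)

Section OneSidedVelocities.
Variable R : realType.
Implicit Types (x : R -> 'rV[R]_3) (t s a b k : R) (sd : side).

Definition on_side sd t : set R :=
  if sd is lside then [set s | s < t] else [set s | t < s].

Lemma at_sideE sd t : at_side sd t = within (on_side sd t) (nbhs t).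
Proof. by case: sd. Qed.

#[export] Instance at_side_proper_filter sd t : ProperFilter (at_side sd t).
Proof.
by case: sd; [exact: at_left_proper_filter|exact: at_right_proper_filter].
Qed.

Lemma near_at_sideP sd t (P : R -> Prop) :
  (\forall s \near at_side sd t, P s) <->
  exists2 d : R, 0 < d & forall s, on_side sd t s -> `|s - t| < d -> P s.
Proof.
rewrite at_sideE near_withinE; split.
  move=> /nbhs_normP[d /= d0 h]; exists d => // s sds st; apply: h => //=.
  by rewrite distrC.
move=> [d d0 h]; apply/nbhs_normP; exists d => //= s ts sds.
by apply: h => //; rewrite distrC.
Qed.

(** The multiplied form has no quotient, so it combines with triangle inequalities and compares
    directly with two-sided expansions. *)
Lemma vel_quotientP x t sd (v : 'rV[R]_3) :
  vel_quotient x t s @[s --> at_side sd t] --> v <->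
  forall e : R, 0 < e -> exists2 d : R, 0 < d & forall s, on_side sd t s ->
    `|s - t| < d -> enorm (x s - x t - (s - t) *: v) <= e * `|s - t|.
Proof.
have E s : on_side sd t s ->
    x s - x t - (s - t) *: v = (s - t) *: (vel_quotient x t s - v).
  move=> ts; rewrite scalerBr /vel_quotient scalerA divff ?scale1r// subr_eq0.
  by case: sd ts => /= ts; rewrite neq_lt ts ?orbT.
split=> [/cvgrPdist_le h e e0|h].
  have /near_at_sideP[d d0 {}h] := h (e / 3) (divr_gt0 e0 (ltr0Sn _ 2)).
  exists d => // s ts st; rewrite E// enormZ mulrC ler_wpM2r//.
  apply: (le_trans (enorm_le_norm _)); rewrite distrC -ler_pdivlMl// mulrC.
  exact: h.
apply/cvgrPdist_le => e e0; apply/near_at_sideP.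
have [d d0 {}h] := h e e0; exists d => // s ts st.
have := h s ts st; rewrite E// enormZ mulrC.
rewrite ler_pM2r => [he|]; first by rewrite distrC (le_trans (norm_le_enorm _)).
by rewrite normr_gt0 subr_eq0; case: sd ts {h E} => /= ts; rewrite neq_lt ts ?orbT.
Qed.

Lemma vel_eq x t sd (v : 'rV[R]_3) :
  vel_quotient x t s @[s --> at_side sd t] --> v ->
  vel sd x t = v.
Proof. by move=> h; apply: cvg_lim h; exact: norm_hausdorff. Qed.

Lemma velP x t sd : has_one_sided_velocities x ->
  forall e : R, 0 < e -> exists2 d : R, 0 < d & forall s, on_side sd t s ->
    `|s - t| < d -> enorm (x s - x t - (s - t) *: vel sd x t) <= e * `|s - t|.
Proof. by move=> hx; apply/vel_quotientP; have [] := hx t sd. Qed.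

(** Both one-sided velocities at nearby times are covered, because breaking times may accumulate at
    [t]. *)
Lemma vel_near x t sd : has_one_sided_velocities x ->
  forall e : R, 0 < e -> exists2 d : R, 0 < d & forall s sd', on_side sd t s ->
    `|s - t| < d -> enorm (vel sd' x s - vel sd x t) <= e.
Proof.
move=> hx e e0; have [_ h] := hx t sd.
have H sd' : exists2 d : R, 0 < d & forall s, on_side sd t s ->
    `|s - t| < d -> enorm (vel sd' x s - vel sd x t) <= e.
  apply/near_at_sideP.
  have /cvgrPdist_le/(_ (e / 3) (divr_gt0 e0 (ltr0Sn _ 2))) := h sd'.
  apply: filterS => s; rewrite distrC => H.
  by apply: (le_trans (enorm_le_norm _)); lra.
have [d1 d10 h1] := H lside; have [d2 d20 h2] := H rside.
exists (Num.min d1 d2); first by rewrite lt_min d10.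
by move=> s [] ts; rewrite lt_min => /andP[? ?]; [apply: h1|apply: h2].
Qed.

Lemma local_segment_bound x t : has_one_sided_velocities x ->
  forall K : R, (forall sd, enorm (vel sd x t) < K) ->
  exists2 d : R, 0 < d & forall s, `|s - t| < d ->
    enorm (x s - x t) <= K * `|s - t| /\ forall sd, enorm (vel sd x s) <= K.
Proof.
move=> hx K hK.
have H sd : exists2 d : R, 0 < d & forall s, on_side sd t s -> `|s - t| < d ->
    enorm (x s - x t) <= K * `|s - t| /\ forall sd, enorm (vel sd x s) <= K.
  (* The gap below [K] serves as tolerance both for the difference quotient and for nearby
     velocities. *)
  have e0 : 0 < K - enorm (vel sd x t) by rewrite subr_gt0.
  have [d1 d10 h1] := velP t sd hx e0; have [d2 d20 h2] := vel_near t sd hx e0.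
  exists (Num.min d1 d2); first by rewrite lt_min d10.
  move=> s ts; rewrite lt_min => /andP[s1 s2]; split=> [|sd'].
    have := h1 s ts s1; have := ler_enormD (x s - x t - (s - t) *: vel sd x t)
      ((s - t) *: vel sd x t).
    by rewrite subrK enormZ; lra.
  have := h2 s sd' ts s2.
  have := ler_enormD (vel sd' x s - vel sd x t) (vel sd x t).
  by rewrite subrK; lra.
have [d1 d10 h1] := H lside; have [d2 d20 h2] := H rside.
exists (Num.min d1 d2); first by rewrite lt_min d10.
move=> s; rewrite lt_min => /andP[s1 s2].
have [st|ts|->] := ltgtP s t; [exact: h1 st s1|exact: h2 ts s2|].
by rewrite !subrr enorm0 normr0 mulr0; split=> // sd; apply/ltW.
Qed.

(** A mean value inequality for functions whose derivative may fail to exist at accumulating times.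
    Continuous induction adds up local bounds; these need a slope [K] strictly above [k], which then
    decreases to [k]. *)
Lemma vel_lipschitz x a b k : has_one_sided_velocities x ->
  (forall s sd, a <= s <= b -> enorm (vel sd x s) <= k) ->
  forall s t, a <= s <= b -> a <= t <= b -> enorm (x s - x t) <= k * `|s - t|.
Proof.
move=> hx hk.
suff H K : k < K -> forall u v, u <= v -> a <= u -> v <= b ->
    enorm (x v - x u) <= K * (v - u).
  have {}H u v : u <= v -> a <= u -> v <= b -> enorm (x v - x u) <= k * (v - u).
    move=> uv au vb; apply/ler_addgt0Pr => e e0.
    (* The summand 1 keeps the divisor positive when [u = v]. *)
    have d0 : 0 < v - u + 1 by rewrite ltr_wpDl// subr_ge0.
    have kd : k < k + e / (v - u + 1) by rewrite ltrDl divr_gt0.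
    apply: (le_trans (H _ kd _ _ uv au vb)).
    rewrite mulrDl lerD2l mulrAC ler_pdivrMr// ler_wpM2l ?(ltW e0)//.
    by rewrite lerDl.
  move=> s t /andP[as_ sb] /andP[at_ tb]; case: (leP s t) => st.
    by rewrite enorm_distC ler0_norm ?subr_le0// opprB; apply: H.
  by rewrite ger0_norm ?subr_ge0 ?(ltW st)//; apply: H => //; apply/ltW.
move=> kK.
apply: (segment_induction (P := fun u v => a <= u -> v <= b ->
    enorm (x v - x u) <= K * (v - u))).
  move=> u v w uv vw h1 h2 au wb.
  have := h1 au (le_trans vw wb); have := h2 (le_trans au uv) wb.
  have := ler_enormD (x w - x v) (x v - x u); rewrite subrKA.
  by lra.
move=> t; case: (boolP (a <= t <= b)) => tab; last first.
  (* No segment inside [[a, b]] contains such a [t], so the radius is arbitrary. *)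
  exists 1 => // u v _ ut tv _ au vb; exfalso; move/negP: tab; apply.
  by apply/andP; split; lra.
have [d d0 h] := local_segment_bound hx (fun sd => le_lt_trans (hk t sd tab) kK).
exists d => // u v tu ut tv vt _ _.
have /h[hu _] : `|u - t| < d by rewrite ler0_norm ?subr_le0//; lra.
have /h[hv _] : `|v - t| < d by rewrite ger0_norm ?subr_ge0//; lra.
move: hu hv; rewrite (ler0_norm (_ : u - t <= 0)) ?subr_le0//.
rewrite (ger0_norm (_ : 0 <= v - t)) ?subr_ge0//.
have := ler_enormD (x v - x t) (x t - x u); rewrite subrKA (enorm_distC (x t)).
by lra.
Qed.

(** One-sided limits of the velocity give a bound below 1 near each time; the maximum of two such
    bounds serves adjacent segments. *)
Lemma vel_bound x a b : has_one_sided_velocities x ->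
  (forall sd t, enorm (vel sd x t) < 1) ->
  exists k, [/\ 0 <= k, k < 1 &
    forall s sd, a <= s <= b -> enorm (vel sd x s) <= k].
Proof.
move=> hx h1.
case: (leP a b) => [ab|ba]; last first.
  by exists 0; split=> // s sd /andP[? ?]; exfalso; lra.
move: a b ab; apply: segment_induction => [a b c ab bc|t].
  move=> [k [k0 k1 hk]] [l [l0 l1 hl]]; exists (Num.max k l); split.
  - by rewrite le_max k0.
  - by rewrite gt_max k1.
  move=> s sd /andP[as_ sc]; rewrite le_max; apply/orP.
  case: (leP s b) => sb; first by left; apply: hk; rewrite as_.
  by right; apply: hl; rewrite sc (ltW sb).
pose m := Num.max (enorm (vel lside x t)) (enorm (vel rside x t)).
have m1 : m < 1 by rewrite gt_max !h1.
have m0 : 0 <= m by rewrite le_max enorm_ge0.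
(* The midpoint between [m] and 1 lies strictly above both one-sided speeds at [t]. *)
have [|d d0 h] := @local_segment_bound x t hx ((m + 1) / 2).
  have := lexx m; rewrite {1}ge_max => /andP[? ?].
  by case; lra.
exists d => // u v tu ut tv vt; exists ((m + 1) / 2); split; [lra|lra|].
move=> s sd /andP[us sv]; apply: (h s _).2; rewrite ltr_norml; apply/andP; split; lra.
Qed.

End OneSidedVelocities.

(** * Existence, uniqueness and Lipschitz dependence of the delays *)

Section Delays.
Variable R : realType.
Implicit Types (x : R -> 'rV[R]_3) (t s M k : R) (y : 'rV[R]_3) (sd : side)
  (c : cone).

(** The properties shared by the proton and image trajectories under which the delay equation is
    well posed. *)
Record timelike x : Prop := Timelike {
  timelike_bounded : exists B : R, forall t, enorm (x t) <= B;
  timelike_vel : has_one_sided_velocities x;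
  timelike_speed : forall sd t, enorm (vel sd x t) < 1 }.

Lemma timelike_lipschitz x M : timelike x -> exists k : R, [/\ 0 <= k, k < 1,
  forall s sd, `|s| <= M -> enorm (vel sd x s) <= k &
  forall s t, `|s| <= M -> `|t| <= M -> enorm (x s - x t) <= k * `|s - t|].
Proof.
move=> [_ hx h1]; have [k [k0 k1 hk]] := vel_bound (- M) M hx h1.
exists k; split=> // [s sd|s t]; rewrite !ler_norml; first exact: hk.
exact: (vel_lipschitz hx).
Qed.

Lemma timelike_continuous x : timelike x -> continuous x.
Proof.
move=> [_ hx h1] t; have [d d0 h] := local_segment_bound hx (h1 ^~ t).
apply/cvgrPdist_lt => e e0; apply/nbhs_normP.
exists (Num.min d e); rewrite /= ?lt_min ?d0// => s /=.
rewrite lt_min distrC => /andP[sd se]; rewrite distrC.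
have [+ _] := h s sd; have := norm_le_enorm (x s - x t); lra.
Qed.

Lemma norm_sgM c (a : R) : `|sg c * a| = `|a|.
Proof. by case: c; rewrite /= ?mul1r// mulN1r normrN. Qed.

(** The delay changes by at most |y' - y| + k |s' - s|, and |s' - s| <= |t' - t| + |phi' - phi|; the
    term k |phi' - phi| is absorbed on the left. Equal events give uniqueness, distinct ones
    Lipschitz dependence. *)
Lemma delay_equation_lip c x k t y (phi : R) t' y' (phi' : R) :
  0 <= k -> k < 1 ->
  let s := t + sg c * phi in let s' := t' + sg c * phi' in
  enorm (x s' - x s) <= k * `|s' - s| ->
  phi = enorm (y - x s) -> phi' = enorm (y' - x s') ->
  (1 - k) * `|phi' - phi| <= `|t' - t| + enorm (y' - y).
Proof.
move=> k0 k1 s s' hs e e'.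
have : `|phi' - phi| <= enorm (y' - y) + enorm (x s' - x s).
  rewrite {1}e {1}e'; apply: (le_trans (ler_dist_enorm _ _)).
  rewrite (_ : _ - _ - _ = (y' - y) - (x s' - x s)) ?ler_enormB//.
  by rewrite !opprD !opprK addrACA.
have : `|s' - s| <= `|t' - t| + `|phi' - phi|.
  rewrite (_ : s' - s = (t' - t) + sg c * (phi' - phi)); last by rewrite /s /s'; ring.
  by apply: (le_trans (ler_normD _ _)); rewrite norm_sgM.
move=> /(ler_wpM2l k0).
have : k * `|t' - t| <= `|t' - t| by rewrite ler_piMl// ltW.
lra.
Qed.

Lemma delay_equation_unique c x t y (phi phi' : R) : timelike x ->
  phi = enorm (y - x (t + sg c * phi)) ->
  phi' = enorm (y - x (t + sg c * phi')) ->
  phi = phi'.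
Proof.
move=> hx e e'.
have [k [k0 k1 _ hk]] :=
  timelike_lipschitz (`|t + sg c * phi| + `|t + sg c * phi'|) hx.
have := delay_equation_lip k0 k1 _ e e'.
rewrite !subrr normr0 enorm0 addr0 => H.
have {}H := H (hk _ _ (ler_wpDl (normr_ge0 _) (lexx _))
  (ler_wpDr (normr_ge0 _) (lexx _))).
apply/eqP; rewrite eq_sym -subr_eq0 -normr_le0.
by rewrite -(pmulr_rle0 _ (_ : 0 < 1 - k)) ?subr_gt0.
Qed.

(** Intermediate value theorem for the delay minus the distance: nonpositive at 0, nonnegative at
    [enorm y + B], where [B] bounds the trajectory. *)
Lemma delay_exists c x t y : timelike x ->
  exists phi, 0 <= phi /\ phi = enorm (y - x (t + sg c * phi)).
Proof.
move=> hx; have [B hB] := timelike_bounded hx.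
pose f (phi : R) := phi - enorm (y - x (t + sg c * phi)).
have fc : continuous f.
  move=> phi; apply: cvgB; first exact: cvg_id.
  apply: (cvg_comp (G := nbhs (y - x (t + sg c * phi)))
    (fun p => y - x (t + sg c * p)) (@enorm R)); last exact: enorm_continuous.
  apply: cvgB; first exact: cvg_cst.
  apply: (cvg_comp (G := nbhs (t + sg c * phi)) (fun p => t + sg c * p) x).
    by apply: cvgD; [exact: cvg_cst|apply: cvgM; [exact: cvg_cst|exact: cvg_id]].
  exact: timelike_continuous.
have B0 : 0 <= B by exact: le_trans (enorm_ge0 _) (hB 0).
have b0 : 0 <= enorm y + B by rewrite addr_ge0 ?enorm_ge0.
have f0 : f 0 <= 0 by rewrite /f add0r oppr_le0 enorm_ge0.
have fb : 0 <= f (enorm y + B).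
  rewrite /f subr_ge0 (le_trans (ler_enormB _ _))// lerD2l.
  exact: hB.
have [|phi /[!in_itv]/= /andP[phi0 _] e] := @IVT R f 0 (enorm y + B) 0 b0
  (continuous_subspaceT fc).
  by rewrite ge_min f0 le_max fb orbT.
by exists phi; split=> //; apply/eqP; rewrite -subr_eq0; apply/eqP.
Qed.

Lemma delayP c x t y : timelike x ->
  0 <= delay c x t y /\ delay c x t y = enorm (y - x (cone_time c x t y)).
Proof.
by move=> hx; rewrite /cone_time /delay; case: xgetP => [phi -> //|h];
  have [phi /h] := delay_exists c t y hx.
Qed.

Lemma delay_unique c x t y phi : timelike x ->
  phi = enorm (y - x (t + sg c * phi)) -> delay c x t y = phi.
Proof.
by move=> hx; apply: (delay_equation_unique hx); have [_] := delayP c t y hx.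
Qed.

Lemma delay_gt0 c x t y : timelike x -> y <> x t -> 0 < delay c x t y.
Proof.
move=> hx yx; have [d0 de] := delayP c t y hx.
rewrite lt_neqAle d0 andbT; apply/eqP => e; apply: yx; apply/eqP.
by move: de; rewrite /cone_time -e mulr0 addr0 -subr_eq0 -enorm_eq0 => <-.
Qed.

Lemma delay_le x : timelike x ->
  exists2 B : R, 0 <= B & forall c t y, delay c x t y <= enorm y + B.
Proof.
move=> hx; have [B hB] := timelike_bounded hx.
exists B => [|c t y]; first exact: le_trans (enorm_ge0 _) (hB 0).
have [_ ->] := delayP c t y hx.
by apply: (le_trans (ler_enormB _ _)); rewrite lerD2l.
Qed.

Lemma cone_time_le x : timelike x ->
  exists2 B : R, 0 <= B &
    forall c t y, `|cone_time c x t y| <= `|t| + (enorm y + B).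
Proof.
move=> hx; have [B B0 hB] := delay_le hx; exists B => // c t y.
apply: (le_trans (ler_normD _ _)); rewrite norm_sgM lerD2l ger0_norm//.
by have [] := delayP c t y hx.
Qed.

(** The cone times of all events considered stay in one bounded interval, hence share one
    contraction constant. *)
Lemma delay_lipschitz c x M : timelike x -> exists2 L : R, 0 < L &
  forall t y t' y', `|t| + enorm y <= M -> `|t'| + enorm y' <= M ->
  `|delay c x t' y' - delay c x t y| <= L * (`|t' - t| + enorm (y' - y)).
Proof.
move=> hx; have [B B0 hB] := cone_time_le hx.
have [k [k0 k1 _ hk]] := timelike_lipschitz (M + B) hx.
exists (1 - k)^-1 => [|t y t' y' tM tM']; first by rewrite invr_gt0 subr_gt0.
rewrite ler_pdivlMl ?subr_gt0//; apply: (@delay_equation_lip c x k) => //.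
- by apply: hk; apply: (le_trans (hB _ _ _)); rewrite addrA lerD2r.
- exact: (delayP c t y hx).2.
- exact: (delayP c t' y' hx).2.
Qed.

Lemma cone_time_local c x t y : timelike x -> exists2 L : R, 0 < L &
  forall t' y', `|t' - t| + enorm (y' - y) <= 1 ->
  [/\ `|delay c x t' y' - delay c x t y| <= L * (`|t' - t| + enorm (y' - y)),
      `|cone_time c x t' y' - cone_time c x t y|
        <= L * (`|t' - t| + enorm (y' - y)) &
      enorm (x (cone_time c x t' y') - x (cone_time c x t y))
        <= L * (`|t' - t| + enorm (y' - y))].
Proof.
move=> hx; have [L L0 hL] := delay_lipschitz c (`|t| + enorm y + 1) hx.
have [B B0 hB] := cone_time_le hx.
have [k [k0 k1 _ hk]] := timelike_lipschitz (`|t| + enorm y + 1 + B) hx.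
(* The extra 1 accounts for the displacement of [t] itself in the cone time. *)
exists (L + 1) => [|t' y' h]; first by lra.
have D0 : 0 <= `|t' - t| + enorm (y' - y) by rewrite addr_ge0 ?enorm_ge0.
have M' : `|t'| + enorm y' <= `|t| + enorm y + 1.
  have := ler_normD (t' - t) t; have := ler_enormD (y' - y) y.
  by rewrite !subrK; lra.
have M0 : `|t| + enorm y <= `|t| + enorm y + 1 by lra.
have h1 := hL _ _ _ _ M0 M'.
have h2 : `|cone_time c x t' y' - cone_time c x t y|
    <= (L + 1) * (`|t' - t| + enorm (y' - y)).
  rewrite (_ : cone_time c x t' y' - cone_time c x t y
    = (t' - t) + sg c * (delay c x t' y' - delay c x t y)); last first.
    by rewrite /cone_time; ring.
  apply: (le_trans (ler_normD _ _)); rewrite norm_sgM.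
  by have := enorm_ge0 (y' - y); lra.
split=> //; first by lra.
apply: le_trans h2; apply: (le_trans (hk _ _ _ _)).
- by apply: (le_trans (hB _ _ _)); lra.
- by apply: (le_trans (hB _ _ _)); lra.
- by rewrite ler_piMl// ltW.
Qed.

End Delays.

(** * First-order expansions on space-time and the derivatives they determine *)

Section Expansions.
Variable R : realType.
Implicit Types (f : R -> 'rV[R]_3 -> R) (t d : R) (y g : 'rV[R]_3).

(** Frechet differentiability at [(t, y)] with time derivative [d] and gradient [g]; the sum of the
    time and Euclidean distances is equivalent to the product norm. *)
Definition expansion f t y d g := forall e : R, 0 < e ->
  exists2 r : R, 0 < r & forall t' y', `|t' - t| + enorm (y' - y) < r ->
    `|f t' y' - f t y - (d * (t' - t) + dot g (y' - y))|
      <= e * (`|t' - t| + enorm (y' - y)).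

Lemma expansionB f1 f2 t y d1 d2 g1 g2 :
  expansion f1 t y d1 g1 -> expansion f2 t y d2 g2 ->
  expansion (fun t y => f1 t y - f2 t y) t y (d1 - d2) (g1 - g2).
Proof.
move=> h1 h2 e e0; have e20 : 0 < e / 2 by lra.
have [r1 r10 {}h1] := h1 _ e20; have [r2 r20 {}h2] := h2 _ e20.
exists (Num.min r1 r2); first by rewrite lt_min r10.
move=> t' y'; rewrite lt_min => /andP[/h1 {}h1 /h2 {}h2].
rewrite dotDl dotNl.
set a := f1 t' y' - _ - _ in h1; set b := f2 t' y' - _ - _ in h2.
rewrite (_ : f1 t' y' - _ - _ - _ = a - b); last by rewrite /a /b; ring.
by have := ler_normB a b; lra.
Qed.

Lemma expansion_shift f t y d g s : expansion f (t + s) y d g ->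
  expansion (fun t => f (t + s)) t y d g.
Proof.
move=> h e /h[r r0 {}h]; exists r => // t' y'.
by have := h (t' + s) y'; rewrite opprD addrACA subrr addr0.
Qed.

Definition linear_form d g (z : R * 'rV[R]_3) : R := d * z.1 + dot g z.2.

Lemma linear_form_is_linear d g : linear (linear_form d g).
Proof.
move=> a u v; rewrite /linear_form /= dotDr dotZr.
rewrite /GRing.scale/=; ring.
Qed.

HB.instance Definition _ d g := GRing.isLinear.Build R (R * 'rV[R]_3)%type R _
  (linear_form d g) (linear_form_is_linear d g).

Lemma linear_form_continuous d g : continuous (linear_form d g).
Proof.
move=> z; apply: cvgD.
  by apply: cvgM; [exact: cvg_cst|exact: cvg_fst].
by apply: cvg_dot; [exact: cvg_cst|exact: cvg_snd].
Qed.

Lemma expansion_diff f t y d g : expansion f t y d g ->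
  let F := fun z : R * 'rV[R]_3 => f z.1 z.2 in
  differentiable F (t, y) /\ 'd F (t, y) = linear_form d g :> (_ -> _).
Proof.
move=> h F.
have near0 (e : R) : 0 < e -> \forall z \near (0 : (R * 'rV[R]_3)%type),
    `|F (z + (t, y)) - (F (t, y) + linear_form d g z)| <= e * `|z|.
  (* The 4 compares norms: [|t'| + enorm y'] is at most 1 + 3 times the product norm. *)
  move=> e0; have [r r0 {}h] := h (e / 4) ltac:(lra).
  apply/nbhs_normP; exists (r / 4); first by rewrite /=; lra.
  move=> [t' y'] /=; rewrite sub0r normrN => zr.
  have N : `|t'| + enorm y' <= 4 * `|(t', y')|.
    have /andP[] : (`|t'| <= `|(t', y')|) && (`|y'| <= `|(t', y')|).
      by rewrite prod_normE /= !le_max !lexx orbT.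
    by have := enorm_le_norm y'; lra.
  have Nr : `|t'| + enorm y' < r.
    by apply: (le_lt_trans N); rewrite mulrC -ltr_pdivlMr.
  have := h (t' + t) (y' + y); rewrite !addrK => /(_ Nr) H.
  rewrite opprD addrA.
  apply: (le_trans H); rewrite -mulrA ler_wpM2l ?(ltW e0)//.
  by rewrite mulrC ler_pdivrMr// mulrC.
have dE : 'd F (t, y) = linear_form d g :> (_ -> _).
  apply: diff_unique; first exact: linear_form_continuous.
  by apply/eqaddoP => e e0; exact: near0.
split=> //; apply/diff_locallyP; rewrite dE; split.
  exact: linear_form_continuous.
by apply/eqaddoP => e e0; exact: near0.
Qed.

Lemma expansion_dt f t y d g : expansion f t y d g -> dt f t y = d.
Proof.
move=> h; have [hd hD] := expansion_diff h.
rewrite /dt.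
(* The partial derivative is a directional derivative on the product space, which the differential
   evaluates. *)
transitivity ('D_((1 : R), (0 : 'rV[R]_3)) (fun z : R * 'rV[R]_3 => f z.1 z.2) (t, y)).
  rewrite /derive1 /derive; set l := (fun _ : R => _); set r := (fun _ : R => _).
  suff -> : l = r by [].
  by apply/funext => s; rewrite /l /r /= scaler0 add0r [_%:A]mulr1.
by rewrite deriveE// hD /linear_form /= mulr1 dotC /dot big1 ?addr0// => i _;
  rewrite mxE mul0r.
Qed.

Lemma expansion_grad f t y d g : expansion f t y d g -> grad f t y = g.
Proof.
move=> h; have [hd hD] := expansion_diff h.
apply/rowP => i; rewrite mxE.
transitivity ('D_((0 : R), (delta_mx 0 i : 'rV[R]_3))
  (fun z : R * 'rV[R]_3 => f z.1 z.2) (t, y)).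
  rewrite /derive; set l := (fun _ : R => _); set r := (fun _ : R => _).
  suff -> : l = r by [].
  by apply/funext => s; rewrite /l /r /= scaler0 add0r.
rewrite deriveE// hD /linear_form /= mulr0 add0r /dot (bigD1 i)//= big1 => [|j ji].
  by rewrite mxE !eqxx mulr1 addr0.
by rewrite mxE (negPf ji) andbF mulr0.
Qed.

End Expansions.

(** * First-order expansion of the delays, and of their difference at breaking events *)

Section DelayExpansions.
Variable R : realType.
Implicit Types (x X : R -> 'rV[R]_3) (t s : R) (y n v : 'rV[R]_3) (sd : side)
  (c : cone).

Lemma enorm_normal c x t y : enorm (normal c x t y) <= 1.
Proof.
rewrite /normal; set d := _ - _; rewrite enormZ normfV ger0_norm ?enorm_ge0//.
by have [->|d0] := eqVneq (enorm d) 0; rewrite ?invr0 ?mul0r ?ler01 ?mulVf.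
Qed.

Lemma doppler_bounds c n v : enorm n <= 1 -> enorm v < 1 ->
  1 - enorm v <= 1 + sg c * dot n v /\ 0 < 1 + sg c * dot n v.
Proof.
move=> n1 v1.
have : `|sg c * dot n v| <= enorm v.
  rewrite norm_sgM; apply: (le_trans (dot_le _ _)).
  by rewrite ler_piMl ?enorm_ge0.
by rewrite ler_norml => /andP[? _]; split; lra.
Qed.

Lemma vel_two_sided x s : has_one_sided_velocities x -> ~ breaking x s ->
  forall sd (e : R), 0 < e -> exists2 r : R, 0 < r & forall s', `|s' - s| < r ->
    enorm (x s' - x s - (s' - s) *: vel sd x s) <= e * `|s' - s|.
Proof.
move=> hx /contrapT hs sd e e0.
have hv sd' : vel sd x s = vel sd' x s by case: sd sd' => [] [].
have [r1 r10 h1] := velP s lside hx e0; have [r2 r20 h2] := velP s rside hx e0.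
exists (Num.min r1 r2); first by rewrite lt_min r10.
move=> s'; rewrite lt_min => /andP[s1 s2].
have [ss|ss|->] := ltgtP s' s.
- by rewrite (hv lside); exact: h1 ss s1.
- by rewrite (hv rside); exact: h2 ss s2.
- by rewrite !subrr scale0r subr0 enorm0 normr0 mulr0.
Qed.

(** Implicit differentiation: expand the length of y' - x(s') about y - x(s), insert x(s') - x(s) =
    (s' - s) v + r, where s' - s itself contains phi' - phi, and solve for phi' - phi. Its
    coefficient [1 + sg c * dot n v] is positive because speeds are below 1. *)
Lemma delay_expansion sd c x t y : timelike x -> y <> x t ->
  ~ breaking x (cone_time c x t y) ->
  expansion (delay c x) t y (dt_delay c x (vel sd x) t y)
    (grad_delay c x (vel sd x) t y).
Proof.
move=> hx yx hs; rewrite /dt_delay /grad_delay.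
have [L L0 hL] := cone_time_local c t y hx.
have phi0 := delay_gt0 c hx yx.
have [_ phiE] := delayP c t y hx.
set s := cone_time c x t y in hs hL phiE *.
have n1 := enorm_normal c x t y.
have [_ a0] := doppler_bounds c n1 (timelike_speed hx sd s).
set v := vel sd x s in a0 *; set n := normal c x t y in n1 a0 *.
set phi := delay c x t y in hL phi0 phiE *.
set a := 1 + sg c * dot n v in a0 *.
have nE : n = (enorm (y - x s))^-1 *: (y - x s) by [].
clearbody n.
have w0 : y - x s != 0 by rewrite -enorm_eq0 -phiE gt_eqF.
move=> e e0.
(* Since [|s' - s| <= L * D], this tolerance makes the velocity remainder at most [e * a / 2 * D];
   the other half of [e * a] is left for the quadratic remainder. *)
have e1 : 0 < e * a / (2 * L) by rewrite divr_gt0 ?mulr_gt0.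
have [r0 r00 hv] := vel_two_sided (timelike_vel hx) hs sd e1.
rewrite -/v in hv.
have L1 : 0 < (1 + L) ^+ 2 / phi by rewrite divr_gt0// exprn_gt0//; lra.
(* The three radii serve, in turn, the local Lipschitz estimates, the velocity remainder and the
   quadratic remainder [enorm h ^+ 2 / phi]. *)
exists (Num.min 1 (Num.min (r0 / L) (e * a / 2 / ((1 + L) ^+ 2 / phi)))).
  rewrite !lt_min ltr01 (divr_gt0 r00 L0) (divr_gt0 _ L1)//.
  by rewrite divr_gt0 ?mulr_gt0.
move=> t' y'; set D := `|t' - t| + enorm (y' - y).
rewrite !lt_min => /andP[D1 /andP[D2 D3]].
have [h1 h2 h3] := hL _ _ (ltW D1).
have D0 : 0 <= D by rewrite addr_ge0 ?enorm_ge0.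
have [_ phiE'] := delayP c t' y' hx.
set phi' := delay c x t' y' in h1 phiE' *.
set s' := cone_time c x t' y' in h2 h3 phiE'.
have ss : s' - s = (t' - t) + sg c * (phi' - phi).
  by rewrite /s' /s /cone_time -/phi -/phi'; ring.
rewrite -/phi; clearbody v s' phi' s phi.
have hr : enorm (x s' - x s - (s' - s) *: v) <= e * a / 2 * D.
  apply: (le_trans (hv s' _)).
    by apply: le_lt_trans h2 _; rewrite mulrC -ltr_pdivlMr.
  apply: (le_trans (ler_wpM2l (ltW e1) h2)).
  by rewrite invfM mulrA mulrA mulfVK ?gt_eqF.
set r := x s' - x s - (s' - s) *: v in hr.
have [h hdef] : exists h, h = (y' - y) - (x s' - x s) by eexists.
have hE : h = (y' - y) - ((s' - s) *: v + r) by rewrite hdef /r [_ *: v + _]addrC subrK.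
have hh : enorm h <= (1 + L) * D.
  rewrite hdef; apply: (le_trans (ler_enormB _ _)); rewrite mulrDl mul1r lerD//.
  by rewrite /D lerDr.
have phi'E : phi' = enorm ((y - x s) + h).
  by rewrite phiE' hdef addrACA [y + _]addrC subrK -opprD [x s + _]addrC subrK.
have := enormD_approx h w0; rewrite -phi'E -nE -phiE.
have hq : enorm h ^+ 2 / phi <= e * a / 2 * D.
  rewrite ler_pdivrMr//.
  apply: (@le_trans _ _ (((1 + L) * D) ^+ 2)).
    by rewrite lerXn2r ?nnegrE ?enorm_ge0 ?mulr_ge0//; lra.
  move: D3; rewrite ltr_pdivlMr// mulrA ltr_pdivrMr// => /ltW D3.
  by rewrite exprMn; have := ler_wpM2r D0 D3; lra.
move=> /le_trans /(_ hq).
have hnr : `|dot n r| <= e * a / 2 * D.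
  by apply: (le_trans (dot_le _ _)); apply: le_trans hr; rewrite ler_piMl ?enorm_ge0.
have nh : dot n h =
    dot n (y' - y) - ((t' - t + sg c * (phi' - phi)) * dot n v + dot n r).
  by rewrite hE [LHS]dotDr dotNr (dotDr n (_ *: v)) dotZr ss.
rewrite nh => hd.
have -> : phi' - phi - (- dot n v / a * (t' - t) + dot (a^-1 *: n) (y' - y)) =
  (phi' - phi - (dot n (y' - y) -
     ((t' - t + sg c * (phi' - phi)) * dot n v + dot n r)) - dot n r) / a.
  rewrite dotZl; have : a != 0 by rewrite gt_eqF.
  by rewrite /a => an0; field.
rewrite normrM normfV (gtr0_norm a0) ler_pdivrMr//.
by apply: (le_trans (ler_normB _ _)); lra.
Qed.

(* The side of [s0] on which the cone time lies depends on the trajectory only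
   through its position at time [s0]. *)
Lemma cone_time_side c x t y s0 : timelike x ->
  [/\ (cone_time c x t y < s0) = (t + sg c * enorm (y - x s0) < s0),
      (s0 < cone_time c x t y) = (s0 < t + sg c * enorm (y - x s0)) &
      (cone_time c x t y == s0) = (t + sg c * enorm (y - x s0) == s0)].
Proof.
move=> hx; set s := cone_time c x t y; set a := t + _.
have [k [k0 k1 _ hk]] := timelike_lipschitz (`|s| + `|s0|) hx.
(* As [k < 1], [a] is nearer to [s] than [s0] is, unless [s = s0]; so [a] and [s] lie on the same
   side of [s0]. *)
have h : `|a - s| <= k * `|s0 - s|.
  have -> : a - s = sg c * (enorm (y - x s0) - enorm (y - x s)).
    by rewrite -(delayP c t y hx).2 /a /s /cone_time; ring.
  rewrite norm_sgM (le_trans (ler_dist_enorm _ _))//.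
  rewrite opprB addrC subrKA enorm_distC.
  by apply: hk; rewrite ?lerDl ?lerDr.
have [ss|ss|ss] := ltgtP s s0.
- move: h; rewrite (ger0_norm (_ : 0 <= s0 - s)) ?subr_ge0 ?(ltW ss)//.
  have : k * (s0 - s) < s0 - s by rewrite gtr_pMl// subr_gt0.
  rewrite ler_norml => *; have as0 : a < s0 by lra.
  by rewrite as0 lt_gtF// lt_eqF.
- move: h; rewrite (ler0_norm (_ : s0 - s <= 0)) ?subr_le0 ?(ltW ss)//.
  have : k * - (s0 - s) < - (s0 - s) by rewrite gtr_pMl// oppr_gt0 subr_lt0.
  rewrite ler_norml => *; have as0 : s0 < a by lra.
  by rewrite as0 lt_gtF// gt_eqF.
- move: h; rewrite ss subrr normr0 mulr0 normr_le0 subr_eq0 => /eqP ->.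
  by rewrite ltxx eqxx.
Qed.

(** The delay of [x] already solves the equation of [X] at the shifted event, since the same
    position is seen there; uniqueness concludes. *)
Lemma delay_shift c x X tau t y : timelike x -> timelike X ->
  let s0 := cone_time c x t y in x s0 = X (s0 + tau) ->
  delay c X (t + tau) y = delay c x t y.
Proof.
move=> hx hX s0 xX; have [_ phiE] := delayP c t y hx.
apply: delay_unique => //; rewrite {1}phiE -/s0 xX; congr (enorm (y - X _)).
by rewrite /s0 /cone_time; ring.
Qed.

Lemma cone_time_shift c x X tau t y : timelike x -> timelike X ->
  let s0 := cone_time c x t y in x s0 = X (s0 + tau) ->
  cone_time c X (t + tau) y = s0 + tau.
Proof.
move=> hx hX s0 xX; rewrite {1}/cone_time (delay_shift hx hX xX).
by rewrite /s0 /cone_time; ring.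
Qed.

(* Both cone times lie on the same side of the common breaking time, where the
   two trajectories agree to first order; since the common one-sided speed is
   below 1, the difference of the delays is then of higher order. *)
Lemma Delta_expansion_breaking c x X tau t y : timelike x -> timelike X ->
  let s0 := cone_time c x t y in
  x s0 = X (s0 + tau) -> (forall sd, vel sd x s0 = vel sd X (s0 + tau)) ->
  Delta c x X tau t y = 0 /\ expansion (Delta c x X tau) t y 0 0.
Proof.
move=> hx hX s0 xX vX.
have cX : cone_time c X (t + tau) y = s0 + tau by exact: cone_time_shift.
have D0 : delay c X (t + tau) y = delay c x t y by exact: delay_shift.
split; first by rewrite /Delta D0 subrr.
have [L L0 hL] := cone_time_local c t y hx.
have [K K0 hK] := cone_time_local c (t + tau) y hX.
move=> e e0.
have H sd : exists2 r : R, 0 < r & forall t' y',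
    `|t' - t| + enorm (y' - y) < r ->
    on_side sd s0 (cone_time c x t' y') ->
    `|Delta c x X tau t' y'| <= e * (`|t' - t| + enorm (y' - y)).
  set v := vel sd x s0.
  have v1 : 0 < 1 - enorm v by rewrite subr_gt0; exact: (timelike_speed hx).
  (* The two velocity remainders, at most [L * D] and [K * D] times this tolerance, sum to
     [e * (1 - enorm v) * D]. *)
  have e1 : 0 < e * (1 - enorm v) / (L + K) 
    by apply: divr_gt0; [exact: mulr_gt0|exact: addr_gt0].
  have [r1 r10 h1] := velP s0 sd (timelike_vel hx) e1.
  have [r2 r20 h2] := velP (s0 + tau) sd (timelike_vel hX) e1.
  exists (Num.min 1 (Num.min (r1 / L) (r2 / K))).
    by rewrite !lt_min ltr01 (divr_gt0 r10 L0) divr_gt0.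
  move=> t' y'; set D := `|t' - t| + enorm (y' - y).
  rewrite !lt_min => /andP[D1 /andP[D2 D3]] side'.
  have [_ l2 _] := hL _ _ (ltW D1).
  have := hK (t' + tau) y'; rewrite opprD addrACA subrr addr0 cX => /(_ (ltW D1)).
  move=> [_ k2 _]; rewrite -/D -/s0 in l2 k2.
  have [_ E] := delayP c t' y' hx; have [_ E'] := delayP c (t' + tau) y' hX.
  (* Both side conditions reduce to the position at the breaking time, which is common by [xX]. *)
  have sideX : on_side sd (s0 + tau) (cone_time c X (t' + tau) y').
    have [hl hr _] := cone_time_side c t' y' s0 hx.
    have [hl' hr' _] := cone_time_side c (t' + tau) y' (s0 + tau) hX.
    have tt (a : R) : t' + tau + a = t' + a + tau by ring.
    case: (sd) side' => /=.
      by rewrite hl hl' -xX tt ltrD2r.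
    by rewrite hr hr' -xX tt ltrD2r.
  set s := cone_time c x t' y' in l2 E side'.
  set S := cone_time c X (t' + tau) y' in k2 E' sideX.
  set d := Delta c x X tau t' y'.
  have sS : (s - s0) - (S - (s0 + tau)) = sg c * d.
    by rewrite /s /S /d /Delta /cone_time; ring.
  have hd : `|d| <= enorm (X S - x s).
    rewrite /d /Delta E E' -/s -/S; apply: (le_trans (ler_dist_enorm _ _)).
    by rewrite opprB addrC subrKA.
  have sr : `|s - s0| < r1 by apply: (le_lt_trans l2); rewrite mulrC -ltr_pdivlMr.
  have Sr : `|S - (s0 + tau)| < r2.
    by apply: (le_lt_trans k2); rewrite mulrC -ltr_pdivlMr.
  have {}h1 := h1 s side' sr; have := h2 S sideX Sr.
  have D0' : 0 <= D by rewrite addr_ge0 ?enorm_ge0.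
  rewrite -(vX sd) -xX -/v => {}h2; rewrite -/v in h1.
  clearbody D v s S d s0.
  have {}h1 := le_trans h1 (ler_wpM2l (ltW e1) l2).
  have {}h2 := le_trans h2 (ler_wpM2l (ltW e1) k2).
  have {}hd : `|d| <= `|d| * enorm v + e * (1 - enorm v) * D.
    apply: (le_trans hd).
    (* The times elapsed since the two breaking times differ by [sg c * d], so the linear parts with
       common velocity [v] leave only this multiple of [v]; the rest is the two remainders. *)
    have -> : X S - x s = - ((sg c * d) *: v) +
      ((X S - x s0 - (S - (s0 + tau)) *: v) - (x s - x s0 - (s - s0) *: v)).
      by rewrite -sS; apply/rowP => i; rewrite !mxE; ring.
    apply: (le_trans (ler_enormD _ _)); rewrite enormN enormZ norm_sgM lerD2l.
    apply: (le_trans (ler_enormB _ _)); apply: (le_trans (lerD h2 h1)).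
    by rewrite -mulrDr -mulrDl mulrA [K + L]addrC mulfVK ?gt_eqF ?addr_gt0.
  by rewrite -(ler_pM2r v1); lra.
have [r1 r10 h1] := H lside; have [r2 r20 h2] := H rside.
exists (Num.min r1 r2); first by rewrite lt_min r10.
move=> t' y'; rewrite lt_min => /andP[D1 D2].
rewrite [Delta c x X tau t y]/Delta D0 subrr subr0 mul0r add0r.
rewrite (_ : dot 0 _ = 0) ?subr0; last first.
  by rewrite /dot big1// => i _; rewrite mxE mul0r.
have [ss|ss|ss] := ltgtP (cone_time c x t' y') s0.
- exact: h1 D1 ss.
- exact: h2 D2 ss.
(* At cone time exactly [s0] no velocity enters: the positions agree, so the delay of [x] solves the
   equation of [X]. *)
have [_ E] := delayP c t' y' hx.
suff -> : Delta c x X tau t' y' = 0.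
  by rewrite normr0 mulr_ge0 ?addr_ge0 ?enorm_ge0// ltW.
apply/eqP; rewrite /Delta subr_eq0; apply/eqP; symmetry; apply: delay_unique => //.
rewrite {1}E ss xX -ss; congr (enorm (y' - X _)).
by rewrite /cone_time; ring.
Qed.

End DelayExpansions.

(** * Continuity of delays, normals and velocities at cone times *)

Section Continuity.
Variable R : realType.
Implicit Types (x X : R -> 'rV[R]_3) (t s : R) (y n v : 'rV[R]_3) (sd : side)
  (c : cone) (z : R * 'rV[R]_3).

Lemma near_pair z (P : R * 'rV[R]_3 -> Prop) (r : R) : 0 < r ->
  (forall z', `|z'.1 - z.1| + enorm (z'.2 - z.2) < r -> P z') ->
  \forall z' \near z, P z'.
Proof.
move=> r0 h; apply/nbhs_normP; exists (r / 4); first by rewrite /=; lra.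
move=> [t' y'] /=; case: z h => t y /= h zr.
have /andP[N1 N2] : (`|t - t'| < r / 4) && (`|y - y'| < r / 4).
  by move: zr; rewrite prod_normE /= gt_max.
apply: h; rewrite /= distrC enorm_distC.
by have := enorm_le_norm (y - y'); lra.
Qed.

Lemma delay_continuous c x : timelike x ->
  continuous (fun z => delay c x z.1 z.2).
Proof.
move=> hx z; have [L L0 hL] := cone_time_local c z.1 z.2 hx.
apply/cvgrPdist_lt => e e0.
apply: (near_pair (r := Num.min 1 (e / L))); first by rewrite lt_min ltr01 divr_gt0.
move=> z'; rewrite lt_min => /andP[/ltW/hL[h _ _]]; rewrite ltr_pdivlMr// => h'.
by rewrite distrC (le_lt_trans h)// mulrC.
Qed.

Lemma cone_time_continuous c x : timelike x ->
  continuous (fun z => cone_time c x z.1 z.2).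
Proof.
move=> hx z; apply: cvgD; first exact: cvg_fst.
by apply: cvgM; [exact: cvg_cst|exact: delay_continuous].
Qed.

Lemma normal_continuous c x z : timelike x -> z.2 <> x z.1 ->
  {for z, continuous (fun z => normal c x z.1 z.2)}.
Proof.
move=> hx zx; rewrite /normal.
have d0 : enorm (z.2 - x (cone_time c x z.1 z.2)) != 0.
  by rewrite -(delayP c z.1 z.2 hx).2 gt_eqF ?delay_gt0.
have dc : z'.2 - x (cone_time c x z'.1 z'.2) @[z' --> z]
    --> z.2 - x (cone_time c x z.1 z.2).
  apply: cvgB; first exact: cvg_snd.
  apply: (cvg_comp (G := nbhs (cone_time c x z.1 z.2))
    (fun z' => cone_time c x z'.1 z'.2) x).
    exact: cone_time_continuous.
  exact: timelike_continuous.
apply: cvgZ => //; apply: cvgV => //.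
exact: (cvg_comp (G := nbhs (z.2 - x (cone_time c x z.1 z.2)))
    (fun z' => z'.2 - x (cone_time c x z'.1 z'.2)) (@enorm R) dc (@enorm_continuous _ _)).
Qed.

(** The left velocity is only a representative: as the cone time approaches [s0] from one side, left
    and right velocities have the same limit. The [within] filter selects events by the side of
    their cone time. *)
Lemma vel_cone_time_side sd c x z : timelike x ->
  let s0 := cone_time c x z.1 z.2 in
  vel lside x (cone_time c x z'.1 z'.2)
    @[z' --> within (fun z' => on_side sd s0 (cone_time c x z'.1 z'.2)) (nbhs z)]
  --> vel sd x s0.
Proof.
move=> hx s0; apply/cvgrPdist_le => e e0; rewrite near_withinE.
have [r r0 h] := vel_near s0 sd (timelike_vel hx) e0.
have /cvgrPdist_lt/(_ r r0) := @cone_time_continuous c x hx z.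
apply: filterS => z'; rewrite distrC => zr side'; rewrite distrC.
exact: le_trans (norm_le_enorm _) (h _ _ side' zr).
Qed.

Lemma vel_cone_time_continuous c x z : timelike x ->
  ~ breaking x (cone_time c x z.1 z.2) ->
  {for z, continuous (fun z => vel lside x (cone_time c x z.1 z.2))}.
Proof.
move=> hx /contrapT hs; apply/cvgrPdist_le => e e0.
have hl := @vel_cone_time_side lside c x z hx.
have hr := @vel_cone_time_side rside c x z hx.
move/cvgrPdist_le/(_ e e0) : hl; rewrite near_withinE => hl.
move/cvgrPdist_le/(_ e e0) : hr; rewrite near_withinE => hr.
move: hl hr; apply: filterS2 => z' hl hr.
have [ss|ss|->] := ltgtP (cone_time c x z'.1 z'.2) (cone_time c x z.1 z.2).
- exact: hl.
- by rewrite hs; exact: hr.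
- by rewrite subrr normr0 ltW.
Qed.

Lemma time_shift_continuous (tau : R) :
  continuous (fun z : R * 'rV[R]_3 => (z.1 + tau, z.2)).
Proof.
move=> z; apply: (cvg_pair (G := nbhs (z.1 + tau)) (H := nbhs z.2)
  (f := fun z => z.1 + tau) (g := snd)); last exact: cvg_snd.
by apply: cvgD; [exact: cvg_fst|exact: cvg_cst].
Qed.

End Continuity.

(** * The difference of the two delays: derivatives, bounds and continuity *)

Section Delta.
Variable R : realType.
Variables (x X : R -> 'rV[R]_3) (tau : R) (c : cone).
Implicit Types (t s : R) (y n v : 'rV[R]_3) (sd : side) (z : R * 'rV[R]_3).
Hypotheses (hx : timelike x) (hX : timelike X)
  (hbreak : forall t, breaking x t <-> breaking X (t + tau))
  (hpos : forall t, breaking x t -> x t = X (t + tau))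
  (hvel : forall t, breaking x t -> forall sd, vel sd x t = vel sd X (t + tau)).

(** Trajectories meet at breaking times, so the cone times correspond under the shift; the converse
    exchanges their roles and shifts by [- tau]. *)
Lemma cone_time_breaking t y :
  breaking x (cone_time c x t y) <-> breaking X (cone_time c X (t + tau) y).
Proof.
split=> [b|B].
  rewrite (cone_time_shift hx hX (hpos b)).
  exact: (hbreak _).1.
pose s := cone_time c X (t + tau) y - tau.
have sE : s + tau = cone_time c X (t + tau) y by rewrite subrK.
have b : breaking x s by apply/hbreak; rewrite sE.
have := @cone_time_shift _ c X x (- tau) (t + tau) y hX hx.
rewrite addrK -/s => -> //.
by rewrite -sE addrK (hpos b).
Qed.

Lemma grad_dt_Delta_side0 sd t y : breaking x (cone_time c x t y) ->
  grad_Delta_side sd c x X tau t y = 0 /\ dt_Delta_side sd c x X tau t y = 0.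
Proof.
move=> b; have E := cone_time_shift hx hX (hpos b).
have nE : normal c X (t + tau) y = normal c x t y.
  by rewrite /normal E -(hpos b).
rewrite /grad_Delta_side /dt_Delta_side /grad_delay /dt_delay nE E.
by rewrite -(hvel b) !subrr.
Qed.

(** Either side [sd] gives the true derivatives: at breaking events the side values vanish,
    elsewhere left and right velocities agree for both trajectories. *)
Lemma Delta_expansion sd t y : off_world_lines x X tau (t, y) ->
  expansion (Delta c x X tau) t y (dt_Delta_side sd c x X tau t y)
    (grad_Delta_side sd c x X tau t y).
Proof.
move=> [/= yx yX]; have [b|nb] := pselect (breaking x (cone_time c x t y)).
  have [-> ->] := grad_dt_Delta_side0 sd b.
  by have [] := Delta_expansion_breaking hx hX (hpos b) (hvel b).
have nB : ~ breaking X (cone_time c X (t + tau) y) by move/(cone_time_breaking _ _).2.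
exact: (expansionB (delay_expansion sd hx yx nb)
  (expansion_shift (delay_expansion sd hX yX nB))).
Qed.

Lemma Delta_continuous : continuous (fun z => Delta c x X tau z.1 z.2).
Proof.
move=> z; apply: cvgB; first exact: delay_continuous.
apply: (cvg_comp (G := nbhs (z.1 + tau, z.2)) (fun z => (z.1 + tau, z.2))
  (fun z => delay c X z.1 z.2)); last first.
  exact: (@delay_continuous _ c X hX (z.1 + tau, z.2)).
exact: time_shift_continuous.
Qed.

(** Each delay grows with [y], but [y] cancels in the difference of the distances, leaving the two
    position bounds. *)
Lemma Delta_bounded : exists B : R, forall z, `|Delta c x X tau z.1 z.2| <= B.
Proof.
have [B hB] := timelike_bounded hx; have [B' hB'] := timelike_bounded hX.
exists (B' + B) => z; rewrite /Delta.
rewrite (delayP c z.1 z.2 hx).2 (delayP c (z.1 + tau) z.2 hX).2.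
apply: (le_trans (ler_dist_enorm _ _)); rewrite opprB addrC subrKA.
by apply: (le_trans (ler_enormB _ _)); rewrite lerD.
Qed.

Lemma off_world_lines_open z : off_world_lines x X tau z ->
  \forall z' \near z, off_world_lines x X tau z'.
Proof.
have gen (F : R * 'rV[R]_3 -> 'rV[R]_3) : continuous F -> z.2 <> F z ->
    \forall z' \near z, z'.2 <> F z'.
  move=> Fc zF; have d0 : 0 < `|z.2 - F z|.
    by rewrite normr_gt0 subr_eq0; apply/eqP.
  have /cvgrPdist_lt/(_ _ d0) : z'.2 - F z' @[z' --> z] --> z.2 - F z.
    by apply: cvgB; [exact: cvg_snd|exact: Fc].
  by apply: filterS => z' + e; rewrite e subrr subr0 ltxx.
move=> [zx zX].
have h1 : \forall z' \near z, z'.2 <> x z'.1.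
  apply: (gen (fun z => x z.1)) => // z1.
  apply: (cvg_comp (G := nbhs z1.1) fst x); first exact: cvg_fst.
  exact: timelike_continuous.
have h2 : \forall z' \near z, z'.2 <> X (z'.1 + tau).
  apply: (gen (fun z => X (z.1 + tau))) => // z1.
  apply: (cvg_comp (G := nbhs (z1.1 + tau)) (fun z => z.1 + tau) X).
    by apply: cvgD; [exact: cvg_fst|exact: cvg_cst].
  exact: timelike_continuous.
by near=> z'; split; near: z'.
Unshelve. all: by end_near. Qed.

(* [Phi n v] stands for either of the two closed forms of the derivatives of a
   delay function. *)
Lemma Delta_side_continuous (W : normedModType R)
    (Phi : 'rV[R]_3 -> 'rV[R]_3 -> W) z :
  (forall (F : set_system (R * 'rV[R]_3)) (FF : Filter F) f g n v,
    enorm n <= 1 -> enorm v < 1 -> f @ F --> n -> g @ F --> v ->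
    Phi (f z) (g z) @[z --> F] --> Phi n v) ->
  off_world_lines x X tau z ->
  {for z, continuous (fun z =>
    Phi (normal c x z.1 z.2) (vel lside x (cone_time c x z.1 z.2)) -
    Phi (normal c X (z.1 + tau) z.2)
      (vel lside X (cone_time c X (z.1 + tau) z.2)))}.
Proof.
move=> hPhi [zx zX].
pose sh z := (z.1 + tau, z.2).
have shc : sh z' @[z' --> z] --> sh z := @time_shift_continuous _ tau z.
have ncx := normal_continuous (c := c) hx zx.
have ncX : normal c X (z'.1 + tau) z'.2 @[z' --> z] -->
    normal c X (z.1 + tau) z.2.
  exact: (cvg_comp (G := nbhs (sh z)) sh (fun z => normal c X z.1 z.2) shc
    (@normal_continuous _ c X (sh z) hX zX)).
have [b|nb] := pselect (breaking x (cone_time c x z.1 z.2)); last first.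
  have nB : ~ breaking X (cone_time c X (z.1 + tau) z.2).
    by move/(cone_time_breaking _ _).2.
  have vX := @vel_cone_time_continuous _ c X (sh z) hX nB.
  apply: cvgB; apply: hPhi.
  - exact: enorm_normal.
  - exact: timelike_speed.
  - exact: ncx.
  - exact: vel_cone_time_continuous.
  - exact: enorm_normal.
  - exact: timelike_speed.
  - exact: ncX.
  - exact: (cvg_comp (G := nbhs (sh z)) sh
      (fun z => vel lside X (cone_time c X z.1 z.2)) shc vX).
set s0 := cone_time c x z.1 z.2 in b.
have E : cone_time c X (z.1 + tau) z.2 = s0 + tau := cone_time_shift hx hX (hpos b).
have nE : normal c X (z.1 + tau) z.2 = normal c x z.1 z.2.
  by rewrite /normal E -(hpos b).
(* The two cone times are simultaneously before, after or at their breaking times, by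
   [cone_time_side] and the common position. *)
have [sl sr se] : [/\
    forall z', (cone_time c X (z'.1 + tau) z'.2 < s0 + tau) =
      (cone_time c x z'.1 z'.2 < s0),
    forall z', (s0 + tau < cone_time c X (z'.1 + tau) z'.2) =
      (s0 < cone_time c x z'.1 z'.2) &
    forall z', cone_time c x z'.1 z'.2 = s0 ->
      cone_time c X (z'.1 + tau) z'.2 = s0 + tau].
  split=> z'.
  - have [hl _ _] := cone_time_side c z'.1 z'.2 s0 hx.
    have [hl' _ _] := cone_time_side c (z'.1 + tau) z'.2 (s0 + tau) hX.
    by rewrite hl hl' -(hpos b) (addrAC z'.1) ltrD2r.
  - have [_ hl _] := cone_time_side c z'.1 z'.2 s0 hx.
    have [_ hl' _] := cone_time_side c (z'.1 + tau) z'.2 (s0 + tau) hX.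
    by rewrite hl hl' -(hpos b) (addrAC z'.1) ltrD2r.
  - move=> e; rewrite -e; apply: (cone_time_shift hx hX); rewrite e.
    exact: hpos.
set H := fun z => _ - _.
have H0 z' : cone_time c x z'.1 z'.2 = s0 -> H z' = 0.
  move=> e; have E' := se _ e.
  have nE' : normal c X (z'.1 + tau) z'.2 = normal c x z'.1 z'.2.
    by rewrite /normal E' e -(hpos b).
  by rewrite /H nE' E' e -(hvel b) subrr.
change (H z' @[z' --> z] --> H z); rewrite (H0 z erefl).
(* From either side both terms tend to [Phi] at the same normal and the same one-sided velocity, so
   their difference tends to zero. *)
have side_cvg sd : H z' @[z' -->
    within (fun z' => on_side sd s0 (cone_time c x z'.1 z'.2)) (nbhs z)] --> (0 : W).
  rewrite -(subrr (Phi (normal c x z.1 z.2) (vel sd x s0))).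
  apply: cvgB; apply: hPhi.
  - exact: enorm_normal.
  - exact: timelike_speed.
  - exact: cvg_within_filter.
  - exact: vel_cone_time_side.
  - exact: enorm_normal.
  - exact: timelike_speed.
  - by apply: cvg_within_filter; rewrite -nE.
  - rewrite (hvel b) -E.
    (* This limit is conditioned on the side of the cone time of [X]: [shc] pulls it back along the
       time shift, and [sl], [sr] translate the condition into the one for [x]. *)
    have h := @vel_cone_time_side _ sd c X (sh z) hX.
    apply/cvgrPdist_le => e e0; rewrite near_withinE.
    move/cvgrPdist_le/(_ e e0) : h; rewrite near_withinE => hw.
    have {}hw : \forall z' \near z,
        on_side sd (cone_time c X (z.1 + tau) z.2)
          (cone_time c X (z'.1 + tau) z'.2) ->
        `|vel sd X (cone_time c X (z.1 + tau) z.2) -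
          vel lside X (cone_time c X (z'.1 + tau) z'.2)| <= e := shc _ hw.
    move: hw; apply: filterS => z' hz' side'; apply: hz'.
    by rewrite E; case: (sd) side' => /=; rewrite ?sl ?sr.
apply/cvgrPdist_le => e e0.
have hl := side_cvg lside; have hr := side_cvg rside.
move/cvgrPdist_le/(_ e e0) : hl; rewrite near_withinE => hl.
move/cvgrPdist_le/(_ e e0) : hr; rewrite near_withinE => hr.
move: hl hr; apply: filterS2 => z' hl hr.
have [ss|ss|ss] := ltgtP (cone_time c x z'.1 z'.2) s0.
- exact: hl.
- exact: hr.
- by rewrite H0// subrr normr0 ltW.
Qed.

End Delta.

(** * Two-sided derivatives, and speed bounds for periodic trajectories *)

Section Derivatives.
Variable R : realType.
Implicit Types (x : R -> 'rV[R]_3) (t s : R) (v : 'rV[R]_3) (sd : side).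

(** Two-sided counterpart of [vel_quotientP]: derivatives and one-sided velocities are compared
    through the same estimate. *)
Lemma derivative_quotientP x t v :
  h^-1 *: (x (h + t) - x t) @[h --> (0 : R)^'] --> v <->
  forall e : R, 0 < e -> exists2 r : R, 0 < r & forall s, `|s - t| < r ->
    enorm (x s - x t - (s - t) *: v) <= e * `|s - t|.
Proof.
have E s : s - t != 0 -> x s - x t - (s - t) *: v =
    (s - t) *: ((s - t)^-1 *: (x (s - t + t) - x t) - v).
  by move=> st; rewrite scalerBr scalerA divff// scale1r subrK.
split=> [/cvgrPdist_le h e e0|h].
  have := h (e / 3) (divr_gt0 e0 (ltr0Sn _ 2)).
  move=> /nbhs_normP[r /= r0 {}h]; exists r => // s st.
  have [->|st0] := eqVneq s t.
    by rewrite !subrr scale0r subr0 enorm0 normr0 mulr0.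
  rewrite -subr_eq0 in st0; rewrite E// enormZ mulrC ler_wpM2r//.
  have : `|v - (s - t)^-1 *: (x (s - t + t) - x t)| <= e / 3.
    by apply: h => //=; rewrite sub0r normrN.
  by rewrite distrC => h'; apply: (le_trans (enorm_le_norm _)); lra.
apply/cvgrPdist_le => e e0; have [r r0 {}h] := h e e0.
apply/nbhs_normP; exists r => // u /=; rewrite sub0r normrN => ur u0.
have := h (u + t); rewrite addrK => /(_ ur); have := E (u + t).
rewrite addrK => -> //; rewrite enormZ mulrC ler_pM2r ?normr_gt0// => h'.
by rewrite distrC (le_trans (norm_le_enorm _)).
Qed.

Lemma derivable_expansion x t : derivable x t 1 -> 
  forall e : R, 0 < e -> exists2 r : R, 0 < r & forall s, `|s - t| < r ->
    enorm (x s - x t - (s - t) *: derive1 x t) <= e * `|s - t|.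
Proof.
rewrite /derivable => h; apply/derivative_quotientP; rewrite /derive1.
set f := (fun h : R => _) in h; set g := (fun h : R => _).
suff <- : f = g by [].
by apply/funext => u; rewrite /f /g /= [_%:A]mulr1.
Qed.

Lemma nonbreaking_derivable sd x t : has_one_sided_velocities x ->
  ~ breaking x t -> derivable x t 1 /\ derive1 x t = vel sd x t.
Proof.
move=> hx nb.
have h := (derivative_quotientP x t (vel sd x t)).2 (vel_two_sided hx nb sd).
split; last by apply: cvg_lim h; exact: norm_hausdorff.
rewrite /derivable.
set f := (fun h : R => _) in h; set g := (fun h : R => _).
have -> : g = f by apply/funext => u; rewrite /f /g /= [_%:A]mulr1.
by apply: cvgP h.
Qed.

Lemma derivable_vel_quotient sd x t : derivable x t 1 ->
  vel_quotient x t s @[s --> at_side sd t] --> derive1 x t.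
Proof.
move=> /derivable_expansion h; apply/vel_quotientP => e /h[r r0 {}h].
by exists r => // s _; exact: h.
Qed.

Lemma vel_shift sd x t a : (forall s, x (s + a) = x s) ->
  has_one_sided_velocities x -> vel sd x (t + a) = vel sd x t.
Proof.
move=> xa hx; apply: vel_eq; apply/vel_quotientP => e e0.
have [r r0 h] := velP t sd hx e0; exists r => // s ss sr.
have eq1 : s - (t + a) = s - a - t by rewrite opprD addrA addrAC.
have := h (s - a); rewrite xa eq1 -[x (s - a)]xa subrK; apply.
  by move: ss; case: sd {h} => /=; rewrite ?ltrBlDr ?ltrBrDr.
by rewrite -eq1.
Qed.

Lemma vel_bound_periodic x T : timelike x -> 0 < T ->
  (forall t, x (t + T) = x t) ->
  exists k : R, [/\ 0 <= k, k < 1 & forall sd t, enorm (vel sd x t) <= k].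
Proof.
move=> hx T0 xT; have [k [k0 k1 hk _]] := timelike_lipschitz T hx.
exists k; split=> // sd t.
have xn (n : nat) s : x (s + T *+ n) = x s.
  by elim: n => [|n IH]; rewrite ?mulr0n ?addr0// mulrS addrCA addrC xT IH.
have xz (m : int) s : x (s + T *~ m) = x s.
  by case: m => n; [exact: xn|rewrite NegzE mulrNz -(xn n.+1) subrK].
(* Removing the whole periods contained in [t] moves the time into [[0, T]], where the compact bound
   applies. *)
rewrite -(vel_shift sd t (xz (- Num.floor (t / T))) (timelike_vel hx)).
apply: hk; rewrite mulrNz -mulrzr.
have := floor_le (t / T); have := lt_succ_floor (t / T).
rewrite ler_pdivlMr// ltr_pdivrMr// intrD mulrDl mul1r [T * _]mulrC => h1 h2.
by rewrite ger0_norm; lra.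
Qed.

End Derivatives.

(** * Velocities of the image trajectory *)

Section ImageTrajectory.
Variable R : realType.

Lemma image_vel (xe G : R -> 'rV[R]_3) (mu : R) sd t :
  has_one_sided_velocities xe -> derivable G t 1 ->
  vel_quotient (image_trajectory mu G xe) t s @[s --> at_side sd t]
    --> - derive1 G t + mu *: vel sd xe t.
Proof.
move=> he hG.
have -> : vel_quotient (image_trajectory mu G xe) t =
    (fun s => - vel_quotient G t s + mu *: vel_quotient xe t s).
  apply/funext => s; rewrite /vel_quotient /image_trajectory.
  by apply/rowP => i; rewrite !mxE; ring.
apply: cvgD; first by apply: cvgN; exact: derivable_vel_quotient.
by apply: cvgZr; have [] := he t sd.
Qed.

Lemma C2_at_derivable (G : R -> 'rV[R]_3) t : C2_at G t ->
  derivable G t 1 /\ {for t, continuous (derive1 G)}.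
Proof.
rewrite /C2_at => h.
have h' := nbhs_singleton h.
have {h'} [h1 h2 _] := h'.
split; first exact: h1.
move/derivable1_diffP : h2 => h2.
exact: differentiable_continuous h2.
Qed.

Lemma image_has_one_sided_velocities (xe G : R -> 'rV[R]_3) (mu : R) :
  has_one_sided_velocities xe -> (forall t, C2_at G t) ->
  has_one_sided_velocities (image_trajectory mu G xe).
Proof.
move=> he hG t sd.
have vE sd' s : vel sd' (image_trajectory mu G xe) s
    = - derive1 G s + mu *: vel sd' xe s.
  by apply: vel_eq; apply: image_vel => //; exact: (C2_at_derivable (hG s)).1.
have dG := (C2_at_derivable (hG t)).1.
split; first by have := image_vel (mu := mu) (sd := sd) he dG; apply: cvgP.
move=> sd'; rewrite vE (_ : vel sd' _ = fun s => - derive1 G s + mu *: vel sd' xe s);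
  last by apply/funext.
apply: cvgD; last by apply: cvgZr; exact: (he t sd).2.
apply: cvgN; rewrite at_sideE; apply: cvg_within_filter.
exact: (C2_at_derivable (hG t)).2.
Qed.

(** Sub-luminality in (P2) bounds the speed only where a velocity exists; at breaking times (P3)
    identifies the one-sided velocities with those of the proton. *)
Lemma image_timelike (T mu tau : R) (xe xp G : R -> 'rV[R]_3) :
  bounded_trajectory xe -> has_one_sided_velocities xe -> timelike xp ->
  property_P2 T xe xp mu G tau -> property_P3 xe xp mu G tau ->
  timelike (image_trajectory mu G xe).
Proof.
move=> [_ xeb] he hp [Gb G2 [_ sub] _ brk _ _] h3.
have hX := image_has_one_sided_velocities mu he G2.
split=> //.
  have bnd (f : R -> 'rV[R]_3) : bounded_set (range f) ->
      exists B : R, forall t, enorm (f t) <= B.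
    (* [bounded_set] provides every bound above [M], hence [M + 1]; the 3 passes to the Euclidean
       norm. *)
    move=> [M [Mr h]]; exists (3 * (M + 1)) => t.
    apply: (le_trans (enorm_le_norm _)); rewrite ler_wpM2l//.
    by apply: (h (M + 1)); [rewrite ltrDl|exists t].
  have [B hB] := bnd _ Gb; have [B' hB'] := bnd _ xeb.
  exists (B + `|mu| * B') => t; apply: (le_trans (ler_enormD _ _)).
  by rewrite enormN enormZ lerD// ler_wpM2l.
move=> sd t; have [b|nb] := pselect (breaking (image_trajectory mu G xe) t).
  have bp : breaking xp (t - tau) by apply/brk; rewrite subrK.
  have := h3 _ bp sd; rewrite subrK => <-; exact: timelike_speed.
by have [d <-] := nonbreaking_derivable sd hX nb; exact: sub.
Qed.

End ImageTrajectory.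

(** * Limits and bounds of the closed forms *)

Section ClosedForms.
Variable R : realType.
Implicit Types (x X : R -> 'rV[R]_3) (t k : R) (y n v : 'rV[R]_3) (sd : side)
  (c : cone).

(** The closed forms as functions of normal and velocity alone, the shape in which
    [Delta_side_continuous] takes [Phi]. *)
Definition grad_form c n v : 'rV[R]_3 := (1 + sg c * dot n v)^-1 *: n.

Definition dt_form c n v : R := - dot n v / (1 + sg c * dot n v).

Lemma cvg_doppler (T : Type) (F : set_system T) (FF : Filter F)
    (f g : T -> 'rV[R]_3) c n v : enorm n <= 1 -> enorm v < 1 ->
  f @ F --> n -> g @ F --> v ->
  (1 + sg c * dot (f z) (g z))^-1 @[z --> F] --> (1 + sg c * dot n v)^-1.
Proof.
move=> n1 v1 fn gv; apply: cvgV.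
  by rewrite gt_eqF//; exact: (doppler_bounds c n1 v1).2.
apply: cvgD; first exact: cvg_cst.
by apply: cvgM; [exact: cvg_cst|exact: cvg_dot].
Qed.

Lemma cvg_grad_form (T : Type) (F : set_system T) (FF : Filter F)
    (f g : T -> 'rV[R]_3) c n v : enorm n <= 1 -> enorm v < 1 ->
  f @ F --> n -> g @ F --> v ->
  grad_form c (f z) (g z) @[z --> F] --> grad_form c n v.
Proof. by move=> n1 v1 fn gv; apply: cvgZ => //; exact: cvg_doppler. Qed.

Lemma cvg_dt_form (T : Type) (F : set_system T) (FF : Filter F)
    (f g : T -> 'rV[R]_3) c n v : enorm n <= 1 -> enorm v < 1 ->
  f @ F --> n -> g @ F --> v ->
  dt_form c (f z) (g z) @[z --> F] --> dt_form c n v.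
Proof.
move=> n1 v1 fn gv; apply: cvgM; last exact: cvg_doppler.
by apply: cvgN; exact: cvg_dot.
Qed.

(** The Doppler factor [1 + sg c * dot n v] is at least [1 - k], and normals have length at most
    1. *)
Lemma delay_derivatives_bound sd c x t y k : k < 1 ->
  enorm (vel sd x (cone_time c x t y)) <= k ->
  `|grad_delay c x (vel sd x) t y| <= (1 - k)^-1 /\
  `|dt_delay c x (vel sd x) t y| <= (1 - k)^-1.
Proof.
move=> k1 vk; have n1 := enorm_normal c x t y.
rewrite /grad_delay /dt_delay.
move: (normal c x t y) (vel sd x _) n1 vk => n v n1 vk.
have v1 := le_lt_trans vk k1.
have [h1 h0] := doppler_bounds c n1 v1.
have hk : `|(1 + sg c * dot n v)^-1| <= (1 - k)^-1.
  rewrite normfV gtr0_norm// lef_pV2 ?posrE ?subr_gt0//.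
  by apply: le_trans h1; rewrite lerD2l lerN2.
split.
  apply: (le_trans (norm_le_enorm _)); rewrite enormZ.
  by apply: le_trans hk; rewrite ler_piMr.
rewrite normrM normrN; apply: le_trans hk; rewrite ler_piMl//.
apply: (le_trans (dot_le _ _)); rewrite mulr_ile1 ?enorm_ge0//.
exact: ltW.
Qed.

End ClosedForms.

Lemma bounded_nearI (R : realType) (T : Type) (V : normedModType R) (f : T -> V)
    (A : set T) (B : R) : (forall z, A z -> `|f z| <= B) ->
  [bounded f z | z in A].
Proof.
move=> h; exists B; split; first exact: num_real.
by move=> M BM z Az; apply: (le_trans (h z Az)); exact: ltW.
Qed.

(** Carries continuity from the closed forms to the derivatives, which agree with them on the open
    set off the world lines. *)
Lemma near_continuous (T U : topologicalType) (f g : T -> U) z :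
  (\forall z' \near z, f z' = g z') -> {for z, continuous g} ->
  {for z, continuous f}.
Proof.
move=> fg gc; rewrite /prop_for /continuous_at (nbhs_singleton fg).
apply: cvg_trans gc; apply: near_eq_cvg.
by move: fg; apply: filterS => z' ->.
Qed.

(** The bounds on derivatives depend on how far speeds stay from 1. On bounded sets of events
    compactness ensures this; globally, periodicity does so for the proton and
    [uniformly_sub_luminal] for the image, as [G] need not be periodic. At breaking events the
    derivatives exist and vanish even on a world line. *)
Theorem theorem2p4 (R : realType) (Mp T : R) (xe xp : R -> 'rV[R]_3)
    (mu : R) (G : R -> 'rV[R]_3) (tau : R)
    (horbit : type_ii_orbit Mp T xe xp)
    (hP2 : property_P2 T xe xp mu G tau)
    (hP3 : property_P3 xe xp mu G tau)
    (c : cone) :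
  let X := image_trajectory mu G xe in
  let D := Delta c xp X tau in
  let U := off_world_lines xp X tau in
  let Dz := fun z : R * 'rV[R]_3 => D z.1 z.2 in
  let gradDz := fun z : R * 'rV[R]_3 => grad D z.1 z.2 in
  let dtDz := fun z : R * 'rV[R]_3 => dt D z.1 z.2 in
  [/\ continuous Dz /\ [bounded Dz z | z in setT],
      (forall z, U z -> [/\ differentiable Dz z,
         {for z, continuous gradDz} & {for z, continuous dtDz}]),
      (forall A : set (R * 'rV[R]_3), bounded_set A ->
         [bounded gradDz z | z in A `&` U] /\
         [bounded dtDz z | z in A `&` U]),
      (uniformly_sub_luminal X ->
         [bounded gradDz z | z in U] /\ [bounded dtDz z | z in U])
    & (forall t y, breaking xp (cone_time c xp t y) ->
         [/\ D t y = 0,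
             [/\ differentiable Dz (t, y), grad D t y = 0 & dt D t y = 0] &
             forall sd, grad_Delta_side sd c xp X tau t y = 0 /\
                        dt_Delta_side sd c xp X tau t y = 0])].
Proof.
move=> X D U Dz gradDz dtDz.
have [[be bp [_ he] [_ hp] _ _ _ _] T0 _ xpT _ vp1 _ _] := horbit.
have tp : timelike xp.
  split=> //; have [_ [M [Mr h]]] := bp; exists (3 * (M + 1)) => t.
  apply: (le_trans (enorm_le_norm _)); rewrite ler_wpM2l//.
  by apply: (h (M + 1)); [rewrite ltrDl|exists t].
have tX : timelike X by exact: image_timelike hP2 hP3.
have hbreak : forall t, breaking xp t <-> breaking X (t + tau) :=
  P2_breaking hP2.
have hpos : forall t, breaking xp t -> xp t = X (t + tau) := P2_position hP2.
have hvel : forall t, breaking xp t ->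
  forall sd, vel sd xp t = vel sd X (t + tau) := hP3.
have exU z : U z -> expansion D z.1 z.2 (dt_Delta_side lside c xp X tau z.1 z.2)
    (grad_Delta_side lside c xp X tau z.1 z.2).
  by case: z => t y; exact: Delta_expansion.
have gradE z : U z -> gradDz z = grad_Delta_side lside c xp X tau z.1 z.2.
  by move=> /exU/expansion_grad.
have dtE z : U z -> dtDz z = dt_Delta_side lside c xp X tau z.1 z.2.
  by move=> /exU/expansion_dt.
have brk t y : breaking xp (cone_time c xp t y) ->
    D t y = 0 /\ expansion D t y 0 0.
  by move=> b; exact: Delta_expansion_breaking (hpos _ b) (hvel _ b).
(* The speed of [X] is bounded at non-breaking cone times only, which is what
   [uniformly_sub_luminal] can supply; at breaking ones the side values vanish. *)
have bound (A : set (R * 'rV[R]_3)) (k l : R) : k < 1 -> l < 1 ->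
    (forall z, A z -> enorm (vel lside xp (cone_time c xp z.1 z.2)) <= k) ->
    (forall z, A z -> ~ breaking X (cone_time c X (z.1 + tau) z.2) ->
       enorm (vel lside X (cone_time c X (z.1 + tau) z.2)) <= l) ->
    [bounded gradDz z | z in A `&` U] /\ [bounded dtDz z | z in A `&` U].
  move=> k1 l1 hk hl.
  have B0 : 0 <= (1 - k)^-1 + (1 - l)^-1.
    by rewrite addr_ge0// invr_ge0 subr_ge0 ltW.
  suff H z : A z -> U z -> `|gradDz z| <= (1 - k)^-1 + (1 - l)^-1 /\
      `|dtDz z| <= (1 - k)^-1 + (1 - l)^-1.
    by split; apply: (@bounded_nearI _ _ _ _ _ ((1 - k)^-1 + (1 - l)^-1)) =>
      z [Az Uz]; have [] := H z Az Uz.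
  move=> Az Uz; rewrite gradE// dtE//.
  have [b|nb] := pselect (breaking xp (cone_time c xp z.1 z.2)).
    have [-> ->] := grad_dt_Delta_side0 tp tX hpos hvel lside b.
    by rewrite !normr0.
  have nB : ~ breaking X (cone_time c X (z.1 + tau) z.2).
    by move/(cone_time_breaking c tp tX hbreak hpos _ _).2.
  have [g1 d1] := delay_derivatives_bound k1 (hk z Az).
  have [g2 d2] := delay_derivatives_bound l1 (hl z Az nB).
  by split; apply: (le_trans (ler_normB _ _)); apply: lerD.
split.
- split; first exact: Delta_continuous.
  have [B hB] := Delta_bounded tau c tp tX.
  by apply: (bounded_nearI (B := B)) => z _; exact: hB.
- move=> z Uz; have Unear := off_world_lines_open tp tX Uz.
  split.
  + by have [] := expansion_diff (exU z Uz); case: (z).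
  + have h : {for z, continuous (fun z => grad_Delta_side lside c xp X tau z.1 z.2)}.
      exact: (@Delta_side_continuous _ xp X tau c tp tX hbreak hpos hvel _ (grad_form c)
        z (fun F FF f g n v => @cvg_grad_form R _ F FF f g c n v) Uz).
    apply: near_continuous h.
    by move: Unear; apply: filterS => z' /gradE.
  + have h : {for z, continuous (fun z => dt_Delta_side lside c xp X tau z.1 z.2)}.
      exact: (@Delta_side_continuous _ xp X tau c tp tX hbreak hpos hvel _ (dt_form c)
        z (fun F FF f g n v => @cvg_dt_form R _ F FF f g c n v) Uz).
    apply: near_continuous h.
    by move: Unear; apply: filterS => z' /dtE.
- move=> A [M [_ hM]].
  (* A bounded set of events has cone times in a bounded interval, where speeds stay below a
     constant less than 1. The 4 is again the comparison of norms. *)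
  have {}hM z : A z -> `|z.1| + enorm z.2 <= 4 * (M + 1).
    case: z => t y /(hM (M + 1)); rewrite ltrDl ltr01 => /(_ isT).
    rewrite /= prod_normE /= ge_max => /andP[/= h1 h2].
    by have := enorm_le_norm y; lra.
  have [B B0 hB] := cone_time_le tp; have [B' B'0 hB'] := cone_time_le tX.
  have [k [_ k1 hk _]] := timelike_lipschitz (4 * (M + 1) + B) tp.
  have [l [_ l1 hl _]] := timelike_lipschitz (4 * (M + 1) + `|tau| + B') tX.
  apply: (bound _ k l) => // z Az.
    apply: hk; apply: (le_trans (hB _ _ _)).
    by have := hM z Az; lra.
  move=> _; apply: hl; apply: (le_trans (hB' _ _ _)).
  by have := hM z Az; have := ler_normD z.1 tau; lra.
- move=> [l l1 hl]; have [k [_ k1 hk]] := vel_bound_periodic tp T0 xpT.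
  rewrite -(setTI U); apply: (bound _ k l) => // z _ nB.
  have [d <-] := nonbreaking_derivable lside (timelike_vel tX) nB.
  exact: hl.
- move=> t y b; have [D0 hex] := brk t y b.
  split=> //; last by move=> sd; exact: grad_dt_Delta_side0.
  by split; [have [] := expansion_diff hex|exact: expansion_grad hex
            |exact: expansion_dt hex].
Qed.
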